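(* Let $K$ be a non-archimedean local field, $V$ an $n$-dimensional $K$-vector space with basis $v_1,\dots,v_n$, $G=PGL(V)$, and let $\overline X=U_0^\wedge\times\overline A/\sim$ and the action $\mu$ of $G$ on $\overline X$ be as in the context. Then $\mu:G\times\overline X\to\overline X$ is continuous. Consequently, the inclusion $U_0^\wedge\times\overline A\subseteq G\times\overline A$ induces a homeomorphism from $\overline X$ onto the quotient of $G\times\overline A$ (with quotient topology) by the equivalence relation: $(g,x)\sim(h,y)$ iff there exists $n\in N$ with $\nu(n)x=y$ and $g^{-1}hn\in P_x$.
   Context: Notation: $v$ normalized valuation on $K$, $|x|=q^{-v(x)}$, $\underline n=\{1,\dots,n\}$; ''$\subset$'' is strict inclusion. $T\subset G$ is the image of invertible diagonal matrices w.r.t. $v_1,\dots,v_n$, $N$ its normalizer, $N=T\rtimes W$ with $W$ the permutation matrices ($w(v_i)=v_{w(i)}$). $G$ carries its topology coming from $K$. Compactified apartment: for nonempty $I\subseteq\underline n$, $A_I$ is the real vector space generated by $\overline\eta^I_i$ ($i\in I$) modulo $\sum_{i\in I}\overline\eta^I_i=0$; $A=A_{\underline n}$, $\eta_i=\overline\eta_i^{\underline n}$; $s_I:A\to A_I$ linear, $\eta_i\mapsto\overline\eta^I_i$ ($i\in I$), $\eta_i\mapsto0$ ($i\notin I$); $\overline A=\bigsqcup_{\emptyset\ne I\subseteq\underline n}A_I$. $N$ acts on $\overline A$ (action $\nu$): $t\in T$ induced by $\mathrm{diag}(d_1,\dots,d_n)$ translates $A_I$ by $\sum_{i\in I}-v(d_i)\overline\eta^I_i$;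 $w\in W$ maps $A_I\to A_{w(I)}$ linearly, $\overline\eta^I_i\mapsto\overline\eta^{w(I)}_{w(i)}$. Topology on $\overline A$: base consisting of open subsets of $A$ and sets $\Gamma^I_U=(U+\Delta_I)\cup\bigcup_{I\subseteq J\subset\underline n}s_J(U+\Delta_I)$ for nonempty $I\subset\underline n$, $U\subset A$ open bounded, $\Delta_I=\sum_{i\notin I}\mathbb R_{\ge0}\eta_i$. Groups: for $i\neq j$ let $a_{ij}:A\to\mathbb R$, $a_{ij}(\sum_kz_k\eta_k)=z_i-z_j$, and $U_{ij}\subset G$ the image of the matrices $1+uE_{ij}$, $u\in K$. For $x\in\overline A$, $f_x(a_{ij})=\inf\{t\in\mathbb R: x\in\overline{\{z\in A: a_{ij}(z)\ge -t\}}\}$ (closure in $\overline A$; $\inf\emptyset=\infty$, $\inf\mathbb R=-\infty$), $U_{ij,x}=\{1+uE_{ij}: v(u)\ge f_x(a_{ij})\}$; $U_x$ is generated by all $U_{ij,x}$, $N_x=\{n\in N:\nu(n)x=x\}$, $P_x=N_xU_x$. $Z=\{t\in T:\nu(t)\text{ acts trivially on }A\}$, $U_0^\wedge=U_0Z$ with $0\in A$ the origin. $\overline X$ is the quotient of $U_0^\wedge\times\overline A$ by the equivalence relation $(g,x)\sim(h,y)$ iff $\exists n\in N$ with $\nu(n)x=y$ and $g^{-1}hn\in P_x$, with the quotient topology. The action $\mu$: for every $x\in\overline A$ one has $G=U_0^\wedge NP_x$, and $nP_xn^{-1}=P_{\nu(n)x}$ for $n\in N$. For $z\in\overline X$ the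 class of $(u,x)\in U_0^\wedge\times\overline A$ and $g\in G$, write $gu=vnh$ with $v\in U_0^\wedge$, $n\in N$, $h\in P_x$, and let $\mu(g,z)$ be the class of $(v,\nu(n)x)$; this is a well-defined action of $G$ on $\overline X$. *)

(* Defs.v *)
From HB Require Import structures.
From mathcomp Require Import all_boot all_order all_algebra all_fingroup.
From mathcomp Require Import classical_sets boolp reals constructive_ereal ereal.
From Stdlib Require Import ClassicalEpsilon.

Set Implicit Arguments.
Unset Strict Implicit.
Unset Printing Implicit Defensive.

Import Order.TTheory GRing.Theory Num.Theory.
Local Open Scope ring_scope.

Definition prod_open (A B : Type) (opA : (A -> Prop) -> Prop)
  (opB : (B -> Prop) -> Prop) : (A * B -> Prop) -> Prop :=
  fun S => forall p, S p -> exists (U : A -> Prop) (V : B -> Prop),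
    [/\ opA U, opB V, U p.1, V p.2 & forall a b, U a -> V b -> S (a, b)].

Definition sub_open (T : Type) (P : T -> Prop) (op : (T -> Prop) -> Prop)
  : ({x : T | P x} -> Prop) -> Prop :=
  fun S => exists O, op O /\ forall x : {x : T | P x}, S x <-> O (proj1_sig x).

Definition quot (T : Type) (Rl : T -> T -> Prop) :=
  {C : T -> Prop | exists x, C = Rl x}.

Definition qproj (T : Type) (Rl : T -> T -> Prop) (x : T) : quot Rl :=
  exist _ (Rl x) (ex_intro _ x erefl).

Definition quot_open (T : Type) (Rl : T -> T -> Prop)
  (op : (T -> Prop) -> Prop) : (quot Rl -> Prop) -> Prop :=
  fun S => op (fun x => S (qproj Rl x)).

Definition cont (A B : Type) (opA : (A -> Prop) -> Prop)
  (opB : (B -> Prop) -> Prop) (f : A -> B) :=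
  forall S, opB S -> opA (fun a => S (f a)).

Definition homeo (A B : Type) (opA : (A -> Prop) -> Prop)
  (opB : (B -> Prop) -> Prop) (f : A -> B) :=
  exists g : B -> A, [/\ forall a, g (f a) = a, forall b, f (g b) = b,
    cont opA opB f & cont opB opA g].

(* Non-archimedean local fields: K with a normalized discrete valuation v   *)
(* (v is only meaningful on nonzero elements; v 0 = +oo by convention,      *)
(* encoded through the predicate [close]), complete, finite residue field.  *)
Section LocalField.
Variables (K : fieldType) (v : K -> int).

Definition close (m : int) (x y : K) := x = y \/ (m <= v (x - y))%R.

Definition nonarch_local_field : Prop :=
  [/\ (forall x y, x != 0 -> y != 0 -> v (x * y) = v x + v y),
      (forall x y, x != 0 -> y != 0 -> x + y != 0 ->
          Num.min (v x) (v y) <= v (x + y)),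
      (exists pi, pi != 0 /\ v pi = 1),
      (forall s : nat -> K,
          (forall m, exists N, forall i j, (N <= i)%N -> (N <= j)%N ->
               close m (s i) (s j)) ->
          exists l, forall m, exists N, forall i, (N <= i)%N -> close m (s i) l)
    &
      (exists r : seq K, forall x, close 0 x 0 ->
          exists2 y, y \in r & close 0 y 0 /\ close 1 x y)].

Definition vE (R : realType) (u : K) : \bar R :=
  if u == 0 then +oo%E else (((v u)%:~R : R)%:E).

End LocalField.

Section Building.
Variables (K : fieldType) (v : K -> int) (R : realType) (n : nat).

Definition mat_open (S : 'M[K]_n -> Prop) :=
  forall M, S M -> exists m : int, forall M' : 'M[K]_n,
    (forall i j, close v m (M' i j) (M i j)) -> S M'.

Definition GLt := {M : 'M[K]_n | M \in unitmx}.
Definition GL_open := @sub_open _ (fun M : 'M[K]_n => is_true (M \in unitmx)) mat_open.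

Definition scal_rel (A B : GLt) :=
  exists c : K, c != 0 /\ proj1_sig B = c *: proj1_sig A.

Definition PGL := quot scal_rel.
Definition PGL_open := @quot_open _ scal_rel GL_open.

(* A point of A_I is represented by its unique coefficient vector z with  *)
(* z i = 0 for i \notin I and sum_(i in I) z i = 0.                        *)
Definition normb (I : {set 'I_n}) (z : 'I_n -> R) : bool :=
  [&& I != finset.set0, [forall i, (i \notin I) ==> (z i == 0)] &
      \sum_(i in I) z i == 0].

Definition nrm (I : {set 'I_n}) (z : 'I_n -> R) : 'I_n -> R :=
  fun i => if i \in I then z i - (\sum_(j in I) z j) / (#|I|%:R) else 0.

Definition Abar := {p : {set 'I_n} * ('I_n -> R) | normb p.1 p.2}.
Definition aI (p : Abar) := (proj1_sig p).1.
Definition az (p : Abar) := (proj1_sig p).2.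

(* the point of A_I represented by sum_(i in I) z i \bar\eta^I_i
   (the default p is only used when I is empty) *)
Definition mkAbar (p : Abar) (I : {set 'I_n}) (z : 'I_n -> R) : Abar :=
  insubd p (I, nrm I z).

Definition Apt (z : 'I_n -> R) := normb finset.setT z.

Definition A_open (U : ('I_n -> R) -> Prop) :=
  (forall z, U z -> Apt z) /\
  forall z, U z -> exists2 e : R, 0 < e & forall z', Apt z' ->
     (forall i, `|z' i - z i| < e) -> U z'.

Definition A_bounded (U : ('I_n -> R) -> Prop) :=
  exists M : R, forall z, U z -> forall i, `|z i| <= M.

(* Gamma^I_U = (U + Delta_I) u \bigcup_{I <= J < n} s_J (U + Delta_I) *)
Definition Gamma (I : {set 'I_n}) (U : ('I_n -> R) -> Prop) (p : Abar) :=
  I \subset aI p /\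
  exists u c, [/\ U u, forall i, 0 <= c i, forall i, i \in I -> c i = 0
             & az p = nrm (aI p) (fun i => u i + c i)].

Definition Abar_base (B : Abar -> Prop) :=
  (exists U, A_open U /\ forall p, B p <-> (aI p = finset.setT /\ U (az p))) \/
  (exists I U, [/\ I != finset.set0, I != finset.setT, A_open U, A_bounded U &
                forall p, B p <-> Gamma I U p]).

Definition Abar_open (S : Abar -> Prop) :=
  forall p, S p -> exists B, [/\ Abar_base B, B p & forall q, B q -> S q].

Definition Abar_closure (S : Abar -> Prop) (p : Abar) :=
  forall O, Abar_open O -> O p -> exists q, O q /\ S q.

Definition is_origin (p : Abar) := aI p = finset.setT /\ az p = (fun _ => 0).

Definition diagK (d : 'I_n -> K) : 'M[K]_n :=
  \matrix_(i, j) (if i == j then d i else 0).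
Definition permK (w : 'S_n) : 'M[K]_n :=
  \matrix_(i, j) (if i == w j then 1 else 0).   (* w(v_j) = v_(w j) *)

Definition nuact (d : 'I_n -> K) (w : 'S_n) (p : Abar) : Abar :=
  let I' := ((fun i => w i) @: aI p) in
  mkAbar p I' (fun j => if j \in I' then az p ((w^-1)%g j) - (v (d j))%:~R
                        else 0).

Definition N_mat (M : 'M[K]_n) :=
  exists d w, (forall i, d i != 0) /\ M = diagK d *m permK w.

Definition nu_rel (M : 'M[K]_n) (p q : Abar) :=
  exists d w, [/\ forall i, d i != 0, M = diagK d *m permK w & q = nuact d w p].

Definition Z_mat (M : 'M[K]_n) :=
  exists d, [/\ forall i, d i != 0, M = diagK d &
     forall p, aI p = finset.setT -> nuact d 1%g p = p].

(* --- the groups U_x, P_x (all as preimages in GL_n(K)) --- *)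
Inductive gen_grp (S : 'M[K]_n -> Prop) : 'M[K]_n -> Prop :=
| gen1 : gen_grp S 1%:M
| genM a b : S a -> gen_grp S b -> gen_grp S (a *m b)
| genV a b : S a -> a \in unitmx -> gen_grp S b -> gen_grp S (invmx a *m b).

Definition fx (x : Abar) (i j : 'I_n) : \bar R :=
  ereal_inf [set t%:E | t in [set t : R |
    Abar_closure (fun z => aI z = finset.setT /\ - t <= az z i - az z j) x]].

Definition Uij_gen (x : Abar) (M : 'M[K]_n) :=
  exists i j u, [/\ i != j, (fx x i j <= vE v R u)%E &
                 M = 1%:M + u *: delta_mx i j].

Definition U_mat (x : Abar) (M : 'M[K]_n) :=
  exists c B, [/\ c != 0, gen_grp (Uij_gen x) B & M = c *: B].

Definition P_mat (x : Abar) (M : 'M[K]_n) :=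
  exists A B, [/\ N_mat A, nu_rel A x x, U_mat x B & M = A *m B].

Definition Uhat_mat (M : 'M[K]_n) :=
  exists x0 A B, [/\ is_origin x0, U_mat x0 A, Z_mat B & M = A *m B].

Definition Uhat_G (g : PGL) := exists M : GLt, qproj scal_rel M = g /\
  Uhat_mat (proj1_sig M).

Definition Uhat := {g : PGL | Uhat_G g}.
Definition Uhat_open := @sub_open _ Uhat_G PGL_open.

Definition simG (a b : PGL * Abar) :=
  exists (A B : GLt) (C : 'M[K]_n),
    [/\ qproj scal_rel A = a.1, qproj scal_rel B = b.1, N_mat C,
        nu_rel C a.2 b.2 & P_mat a.2 (invmx (proj1_sig A) *m proj1_sig B *m C)].

Definition simX (a b : Uhat * Abar) :=
  simG (proj1_sig a.1, a.2) (proj1_sig b.1, b.2).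

Definition Xbar := quot simX.
Definition Xbar_open := @quot_open _ simX (prod_open Uhat_open Abar_open).

Definition Ybar := quot simG.
Definition Ybar_open := @quot_open _ simG (prod_open PGL_open Abar_open).

Definition mu (g : PGL) (z : Xbar) : Xbar :=
  epsilon (inhabits z) (fun w =>
    exists (u : Uhat) (x : Abar) (Mg Mu Mv : GLt) (vv : Uhat)
           (Cn Mh : 'M[K]_n) (y : Abar),
      [/\ qproj simX (u, x) = z, qproj scal_rel Mg = g,
          qproj scal_rel Mu = proj1_sig u & qproj scal_rel Mv = proj1_sig vv] /\
      [/\ N_mat Cn, P_mat x Mh,
          proj1_sig Mg *m proj1_sig Mu = proj1_sig Mv *m Cn *m Mh,
          nu_rel Cn x y & w = qproj simX (vv, y)]).

End Building.

(* Main.v *)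
(* Write |a| = e^(-v(a)).  A point x of A_I is the homothety class of the seminorm
   a |-> max_i r_i |a_i| on K^n with r_i = e^(-x_i) for i in I and r_i = 0 otherwise, and
   the pair (g, x) is sent to the class of this seminorm composed with g^-1.  In the
   coordinates r, normalized to have maximum 1, the topology of Abar is the Euclidean
   one, and f_x(a_ij) <= v(u) means r_i |u| <= r_j, so that U_x preserves the seminorm of x.
   Gaussian elimination gives G = U_x N U_y for all x and y; hence P_x is the stabilizer of
   the class of the seminorm of x, and (g, x) ~ (h, y) iff both pairs define the same class.
   Since U_0^ is K^* GL_n(O) modulo scalars, every class coming from Xbar has a canonical
   representative with maximum 1 on the unit ball O^n.  GL_n(O) x Abar is compact, so
   the topology of Xbar is that of uniform convergence of these representatives on O^n,
   for which the action of G is visibly continuous.  The inverse of Xbar -> Ybar is then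
   induced by (g, x) |-> mu(g, [1, x]). *)
Require Import Defs.
From HB Require Import structures.
From mathcomp Require Import all_boot all_order all_algebra all_fingroup.
From mathcomp Require Import classical_sets boolp reals constructive_ereal ereal.
From mathcomp Require Import filter sequences exp.
From mathcomp Require Import ring lra.
From Stdlib Require ClassicalEpsilon.

Set Implicit Arguments.
Unset Strict Implicit.
Unset Printing Implicit Defensive.

Import Order.TTheory GRing.Theory Num.Theory.
Local Open Scope ring_scope.

(** The difficulty is the quotient: rectangles in U_0^ x Abar are usually not saturated, so
    neighbourhoods in [Xbar] cannot be read off from the bases of the two factors. They are
    described by norms on O^n instead, and compactness is spent on one inclusion only, that open
    sets of the quotient are open for uniform convergence. It enters through limits along one
    ultrafilter, so that matrix entries, entries of inverses and coordinates of points converge at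
    the same time. Boundary points have vanishing weights, and a pivot maximizing r_i |M_ij| / s_j
    is then meaningless; a choice of pivot by cases keeps the decomposition U_x N U_y valid there.
    This form with two different points is what produces the element n in the equivalence relation
    and in [mu]. An element of G outside K^* GL_n(O) does not preserve the maximum on O^n up to a
    common factor, so it acts by composition followed by a rescaling that depends on the point; the
    estimates have to control that factor. *)

(** * Maxima of finite families of real numbers *)

Section VectorMax.
Variables (R : realType) (n : nat).
Implicit Types (f g : 'I_n -> R).

Definition vmax f : R := \big[Num.max/0]_i f i.

Lemma vmax_ge0 f : 0 <= vmax f.
Proof. exact: bigmax_ge_id. Qed.

Lemma vmax_ub f i : f i <= vmax f.
Proof. exact: le_bigmax. Qed.

Lemma vmax_le f c : 0 <= c -> (forall i, f i <= c) -> vmax f <= c.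
Proof. by move=> c0 h; apply: bigmax_le. Qed.

Lemma vmax_lt f c : 0 < c -> (forall i, f i < c) -> vmax f < c.
Proof. by move=> c0 h; apply: bigmax_lt. Qed.

Lemma vmax_attained f : 0 < vmax f -> exists i, vmax f = f i.
Proof.
move=> f0; apply: contrapT => h.
suff : vmax f < vmax f by rewrite ltxx.
apply: vmax_lt => // i; rewrite lt_neqAle vmax_ub andbT.
by apply/eqP => e; apply: h; exists i.
Qed.

Lemma vmaxZ c f : 0 <= c -> vmax (fun i => c * f i) = c * vmax f.
Proof.
rewrite le_eqVlt => /orP[/eqP <-|c0].
  by apply/le_anti; rewrite mul0r vmax_ge0 vmax_le// => i; rewrite mul0r.
apply/le_anti/andP; split.
  apply: vmax_le => [|i]; first by rewrite mulr_ge0 ?vmax_ge0// ltW.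
  by rewrite ler_pM2l// vmax_ub.
rewrite -ler_pdivlMl//; apply: vmax_le => [|i].
  by rewrite mulr_ge0 ?vmax_ge0// invr_ge0 ltW.
by rewrite ler_pdivlMl// (vmax_ub (fun i => c * f i)).
Qed.

Lemma eq_vmax f g : f =1 g -> vmax f = vmax g.
Proof. by move=> e; apply: eq_bigr => i _; exact: e. Qed.

Lemma vmax_dist f g e : 0 <= e -> (forall i, `|f i - g i| <= e) ->
  `|vmax f - vmax g| <= e.
Proof.
move=> e0 h; rewrite ler_distl; apply/andP; split.
  rewrite lerBlDr; apply: vmax_le => [|i].
    by rewrite addr_ge0 ?vmax_ge0.
  have := h i; rewrite ler_distl => /andP[+ _]; rewrite lerBlDr => /le_trans; apply.
  by rewrite lerD2r vmax_ub.
apply: vmax_le => [|i]; first by rewrite addr_ge0 ?vmax_ge0.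
have := h i; rewrite ler_distl => /andP[_ /le_trans]; apply.
by rewrite lerD2r vmax_ub.
Qed.

(* Only the scale of the second pair enters the bound; in the uses [s] and [s0]
   are the maxima of the families that [a] and [b] belong to. *)
Lemma normalized_dist (a b s s0 e : R) : 0 <= a -> a <= s -> 0 < s0 ->
  `|s - s0| <= e -> `|a - b| <= e -> `|a / s - b / s0| <= 2 * e / s0.
Proof.
move=> a0 as0 s00 hs hab.
have s'0 : 0 < s0^-1 by rewrite invr_gt0.
(* The change of denominator is weighted by a / s <= 1, so it costs no more than the change of
   numerator. If s = 0 then a = 0, and both sides agree since division by 0 gives 0. *)
have -> : a / s - b / s0 = ((a / s) * (s0 - s) + (a - b)) / s0.
  have [sz|snz] := eqVneq s 0.
    have -> : a = 0 by apply/le_anti; rewrite a0 -sz as0.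
    by rewrite !mul0r !add0r mulNr.
  by field; rewrite snz (gt_eqF s00).
rewrite normrM (ger0_norm (ltW s'0)) ler_pM2r//.
apply: le_trans (ler_normD _ _) _.
rewrite mulr2n mulrDl mul1r lerD// normrM distrC.
have s_ge0 : 0 <= s by apply: le_trans as0.
rewrite ger0_norm ?divr_ge0//.
apply: le_trans (_ : 1 * `|s - s0| <= _); last by rewrite mul1r.
apply: ler_wpM2r => //.
have [->|snz] := eqVneq s 0; first by rewrite invr0 mulr0.
by rewrite ler_pdivrMr ?mul1r// lt_def snz.
Qed.

Lemma uniform_radius (P : 'I_n -> R -> Prop) :
  (forall i d d', d' <= d -> P i d -> P i d') ->
  (forall i, exists2 d : R, 0 < d & P i d) -> exists2 d : R, 0 < d & forall i, P i d.
Proof.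
move=> Pmon h.
have {}h : forall i, exists d, 0 < d /\ P i d by move=> i; have [d] := h i; exists d.
have [d hd] := choice h.
exists (\big[Num.min/1]_i d i).
  by apply: lt_bigmin => // i _; case: (hd i).
by move=> i; apply: (Pmon i (d i)); [exact: bigmin_le|case: (hd i)].
Qed.

Lemma ball_radius (c z : 'I_n -> R) (e : R) : (forall i, `|z i - c i| < e) ->
  exists2 d : R, 0 < d &
    forall t, (forall i, `|t i - z i| < d) -> forall i, `|t i - c i| < e.
Proof.
move=> ze.
have [||d d0 hd] := @uniform_radius (fun i d => forall t, `|t - z i| < d -> `|t - c i| < e).
- by move=> i a b ba h t ht; apply: h; apply: lt_le_trans ht ba.
- move=> i; exists (e - `|z i - c i|); first by rewrite subr_gt0.
  move=> t ht; rewrite -[t](subrK (z i)) -addrA.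
  by apply: le_lt_trans (ler_normD _ _) _; rewrite -ltrBrDr.
by exists d => // t ht i; exact: hd.
Qed.

End VectorMax.

(** * The absolute value of K with base e *)

Section AbsoluteValue.
Variables (K : fieldType) (v : K -> int) (R : realType).
Hypothesis Kloc : nonarch_local_field v.

(** With base e rather than q, the translation by -v(d_i) on an apartment is the division of the
    weight e^(-z_i) by |d_i|, without any constant. The value at 0 is set apart because [v 0]
    carries no information. *)
Definition absK (x : K) : R := if x == 0 then 0 else expR (- (v x)%:~R).

Lemma valM x y : x != 0 -> y != 0 -> v (x * y) = v x + v y.
Proof. by case: Kloc => + _ _ _ _; apply. Qed.

Lemma val1 : v 1 = 0.
Proof.
have := valM (oner_neq0 K) (oner_neq0 K); rewrite mulr1 => /eqP.
by rewrite -subr_eq subrr => /eqP <-.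
Qed.

Lemma absK0 : absK 0 = 0. Proof. by rewrite /absK eqxx. Qed.

Lemma absK_ge0 x : 0 <= absK x.
Proof. by rewrite /absK; case: ifP => // _; exact: expR_ge0. Qed.

Lemma absK_eq0 x : (absK x == 0) = (x == 0).
Proof. by rewrite /absK; case: ifP => h; rewrite ?eqxx// gt_eqF// expR_gt0. Qed.

Lemma absK_gt0 x : (0 < absK x) = (x != 0).
Proof. by rewrite lt_def absK_eq0 absK_ge0 andbT. Qed.

Lemma absKM x y : absK (x * y) = absK x * absK y.
Proof.
rewrite /absK mulf_eq0; have [->|x0] := eqVneq x 0; first by rewrite /= mul0r.
have [->|y0] := eqVneq y 0; first by rewrite orbT /= mulr0.
by rewrite /= valM// -expRD intrD opprD.
Qed.

Lemma absK1 : absK 1 = 1.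
Proof. by rewrite /absK oner_eq0 val1 oppr0 expR0. Qed.

Lemma absKV x : absK x^-1 = (absK x)^-1.
Proof.
have [->|x0] := eqVneq x 0; first by rewrite invr0 absK0 invr0.
apply: (@mulfI _ (absK x)); first by rewrite absK_eq0.
by rewrite -absKM !divff ?absK_eq0// absK1.
Qed.

Lemma absKN x : absK (- x) = absK x.
Proof.
suff e : absK (-1) = 1 by rewrite -mulN1r absKM e mul1r.
have := absKM (-1) (-1); rewrite mulrNN mulr1 absK1 => /esym/eqP.
by rewrite -expr2 sqrf_eq1 => /orP[/eqP//|/eqP e]; have := absK_ge0 (-1); rewrite e; lra.
Qed.

Lemma absKD x y c : absK x <= c -> absK y <= c -> absK (x + y) <= c.
Proof.
have [->|x0] := eqVneq x 0; first by rewrite add0r.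
have [->|y0] := eqVneq y 0; first by rewrite addr0.
have [->|xy0] := eqVneq (x + y) 0; first by rewrite absK0 => + _; apply: le_trans; exact: absK_ge0.
case: Kloc => _ /(_ _ _ x0 y0 xy0) + _ _ _.
rewrite /absK (negbTE x0) (negbTE y0) (negbTE xy0) ge_min => /orP[] h hx hy.
  by apply: le_trans hx; rewrite ler_expR lerN2 ler_int.
by apply: le_trans hy; rewrite ler_expR lerN2 ler_int.
Qed.

Lemma absKB x y c : absK x <= c -> absK y <= c -> absK (x - y) <= c.
Proof. by move=> hx hy; apply: absKD => //; rewrite absKN. Qed.

Lemma absK_distC x y : absK (x - y) = absK (y - x).
Proof. by rewrite -absKN opprB. Qed.

Lemma absK_sum (I : Type) (r : seq I) (P : pred I) (F : I -> K) c : 0 <= c ->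
  (forall i, P i -> absK (F i) <= c) -> absK (\sum_(i <- r | P i) F i) <= c.
Proof.
move=> c0 h; elim/big_ind: _ => //; first by rewrite absK0.
by move=> x y; exact: absKD.
Qed.

Definition eps (m : int) : R := expR (- m%:~R).

Lemma eps_gt0 m : 0 < eps m. Proof. exact: expR_gt0. Qed.

Lemma closeP m x y : Defs.close v m x y <-> absK (x - y) <= eps m.
Proof.
rewrite /Defs.close /absK /eps; have [e|xy] := eqVneq (x - y) 0.
  by split=> [_|_]; [rewrite expR_ge0|left; apply/eqP; rewrite -subr_eq0 e].
split=> [[e|h]|].
- by move: xy; rewrite e subrr eqxx.
- by rewrite ler_expR lerN2 ler_int.
- by rewrite ler_expR lerN2 ler_int; right.
Qed.

Lemma uniformizer : exists pi : K, pi != 0 /\ absK pi = eps 1.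
Proof.
case: Kloc => _ _ [p [p0 p1]] _ _; exists p; split => //.
by rewrite /absK (negbTE p0) p1.
Qed.

Lemma eps_small (e : R) : 0 < e -> exists2 m : nat, (0 < m)%N & eps m%:Z <= e.
Proof.
move=> e0.
have e'0 : 0 < e^-1 by rewrite invr_gt0.
set m := (Num.bound e^-1).+1; exists m => //.
rewrite /eps expRN -[e]invrK lef_pV2 ?posrE ?expR_gt0//.
apply: le_trans (ltW (archi_boundP (ltW e'0))) _.
apply: le_trans (expR_ge1Dx _).
by rewrite -pmulrn /m -addn1 natrD; lra.
Qed.

End AbsoluteValue.

(** * Weights of maximum 1 as coordinates on the compactified apartment *)

Section Coordinates.
Variables (R : realType) (n : nat).
Implicit Types (p q : Abar R n) (I : {set 'I_n}) (z : 'I_n -> R).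

Definition wt I z (i : 'I_n) : R := if i \in I then expR (- z i) else 0.

(* The point of A_I with coefficients z is the homothety class of the seminorm
   with weights e^(-z_i) on I and 0 off I, that is, z_i = +oo off I; [rc] scales
   the weights to have maximum 1. *)
Definition rc p (i : 'I_n) : R := wt (aI p) (az p) i / vmax (wt (aI p) (az p)).

Lemma aI_neq0 p : aI p != finset.set0.
Proof. by case: p => -[I z] /= h; case/and3P: (h). Qed.

Lemma az_out p i : i \notin aI p -> az p i = 0.
Proof. by case: p => -[I z] /= h; case/and3P: (h) => _ /forallP /(_ i) /implyP k _ /k /eqP. Qed.

Lemma az_sum p : \sum_(i in aI p) az p i = 0.
Proof. by case: p => -[I z] /= h; case/and3P: (h) => _ _ /eqP. Qed.

Lemma Abar_eq p q : aI p = aI q -> az p = az q -> p = q.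
Proof.
move=> hI hz; apply: val_inj; move: hI hz; rewrite /aI /az /=.
by case: (sval p) (sval q) => ? ? [? ?] /= -> ->.
Qed.

Lemma wt_ge0 I z i : 0 <= wt I z i.
Proof. by rewrite /wt; case: ifP => // _; rewrite expR_ge0. Qed.

Lemma wt_gt0 I z i : (0 < wt I z i) = (i \in I).
Proof. by rewrite /wt; case: ifP; rewrite ?expR_gt0 ?ltxx. Qed.

Lemma vmax_wt_gt0 I z : I != finset.set0 -> 0 < vmax (wt I z).
Proof.
case/set0Pn => i iI; apply: lt_le_trans (vmax_ub _ i).
by rewrite wt_gt0.
Qed.

Lemma rc_ge0 p i : 0 <= rc p i.
Proof. by rewrite divr_ge0 ?wt_ge0 ?vmax_ge0. Qed.

Lemma rc_gt0 p i : (0 < rc p i) = (i \in aI p).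
Proof. by rewrite /rc pmulr_lgt0 ?wt_gt0// invr_gt0 vmax_wt_gt0// aI_neq0. Qed.

Lemma rc_eq0 p i : i \notin aI p -> rc p i = 0.
Proof. by rewrite /rc /wt => /negbTE ->; rewrite mul0r. Qed.

Lemma rc_le1 p i : rc p i <= 1.
Proof. by rewrite ler_pdivrMr ?mul1r ?vmax_ub// vmax_wt_gt0// aI_neq0. Qed.

Lemma rc_max p : exists i, rc p i = 1.
Proof.
have h := vmax_wt_gt0 (az p) (aI_neq0 p).
have [i e] := vmax_attained h; exists i.
by rewrite /rc -e divff// gt_eqF.
Qed.

Lemma nrm_out I z i : i \notin I -> nrm I z i = 0.
Proof. by rewrite /nrm => /negbTE ->. Qed.

Lemma card_neq0 I : I != finset.set0 -> #|I|%:R != 0 :> R.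
Proof. by rewrite pnatr_eq0 cards_eq0. Qed.

Lemma normb_nrm I z : I != finset.set0 -> normb I (nrm I z).
Proof.
move=> I0; apply/and3P; split => //.
  by apply/forallP => i; apply/implyP => /nrm_out ->.
rewrite (eq_bigr (fun i => z i - (\sum_(j in I) z j) / #|I|%:R)); last first.
  by move=> i iI; rewrite /nrm iI.
by rewrite sumrB sumr_const -[X in _ - X]mulr_natr divfK ?subrr ?card_neq0.
Qed.

Lemma nrm_shift I z z' c : I != finset.set0 ->
  (forall i, i \in I -> z i = z' i + c) -> nrm I z = nrm I z'.
Proof.
move=> I0 h; apply/funext => i; rewrite /nrm; case: ifP => // iI.
rewrite (eq_bigr (fun i => z' i + c)); last exact: h.
rewrite big_split/= sumr_const -[X in _ - (_ + X) / _]mulr_natr mulrDl mulfK ?card_neq0//.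
by rewrite h//; ring.
Qed.

Lemma nrm_id p : nrm (aI p) (az p) = az p.
Proof.
apply/funext => i; rewrite /nrm az_sum mul0r subr0.
by case: ifP => // /negbT /az_out.
Qed.

Lemma nrm_setT_id z : \sum_i z i = 0 -> nrm finset.setT z = z.
Proof.
move=> h; have e : \sum_(j in finset.setT) z j = 0.
  by rewrite -[RHS]h; apply: eq_bigl => j; rewrite inE.
by apply/funext => i; rewrite /nrm finset.in_setT e mul0r subr0.
Qed.

Lemma Apt_sum z : (0 < n)%N -> Apt z <-> \sum_i z i = 0.
Proof.
move=> n0; rewrite /Apt /normb; split.
  by case/and3P => _ _ /eqP h; rewrite -[RHS]h; apply: eq_bigl => i; rewrite inE.
move=> h; apply/and3P; split.
- by apply/set0Pn; exists (Ordinal n0); rewrite inE.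
- by apply/forallP => i; rewrite inE.
- by apply/eqP; rewrite -[RHS]h; apply: eq_bigl => i; rewrite inE.
Qed.

Lemma exists_point I z : I != finset.set0 ->
  exists p, aI p = I /\ az p = nrm I z.
Proof. by move=> I0; exists (exist _ (I, nrm I z) (normb_nrm z I0)). Qed.

(** [nrm] subtracts a constant on the index set, which multiplies all weights by one factor, and
    division by the maximum removes it. So any representative of a point of A_I computes [rc]. *)
Lemma rc_nrm p z i : az p = nrm (aI p) z ->
  rc p i = wt (aI p) z i / vmax (wt (aI p) z).
Proof.
move=> h; pose c := expR ((\sum_(j in aI p) z j) / #|aI p|%:R) : R.
have e j : wt (aI p) (az p) j = c * wt (aI p) z j.
  rewrite /wt h /nrm; case: ifP => ji; last by rewrite mulr0.
  by rewrite ji -expRD opprB.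
have c0 : 0 < c by exact: expR_gt0.
rewrite /rc e (eq_vmax e) vmaxZ ?(ltW c0)//.
by rewrite -mulf_div divff ?gt_eqF// mul1r.
Qed.

Lemma az_rc p : az p = nrm (aI p) (fun i => - ln (rc p i)).
Proof.
rewrite -{1}(nrm_id p); pose c := - ln (vmax (wt (aI p) (az p))).
apply: (@nrm_shift _ _ _ c) => [|i ip]; first exact: aI_neq0.
have v0 := vmax_wt_gt0 (az p) (aI_neq0 p).
rewrite /rc ln_div ?posrE ?wt_gt0// /wt ip expRK /c; ring.
Qed.

(** Under -ln the factor [c] becomes an additive constant, which the normalization of coefficients
    absorbs. Together with [rc_surj] this identifies Abar with the nonnegative families of maximum
    1. *)
Lemma rc_inj p q c : (forall i, rc p i = c * rc q i) -> p = q.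
Proof.
move=> h.
have c0 : 0 < c.
  have [i e] := rc_max p; rewrite ltNge; apply/negP => c0.
  by have := mulr_le0_ge0 c0 (rc_ge0 q i); rewrite -h e ler10.
have eI : aI p = aI q.
  by apply/setP => i; rewrite -!rc_gt0 h pmulr_rgt0.
apply: Abar_eq => //; rewrite !az_rc eI.
apply: (@nrm_shift _ _ _ (- ln c)) => [|i iq]; first exact: aI_neq0.
by rewrite h lnM ?posrE ?rc_gt0// opprD addrC.
Qed.

Lemma rc_surj (r : 'I_n -> R) : (forall i, 0 <= r i) -> vmax r = 1 ->
  exists p, forall i, rc p i = r i.
Proof.
move=> r0 r1; pose I := [set i | 0 < r i]%SET.
have I0 : I != finset.set0.
  have [|i e] := @vmax_attained _ _ r; first by rewrite r1.
  by apply/set0Pn; exists i; rewrite inE -e r1.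
have [p [pI pz]] := exists_point (fun i => - ln (r i)) I0.
exists p => i; rewrite (@rc_nrm p (fun i => - ln (r i))) pI//.
have e : wt I (fun i => - ln (r i)) =1 r.
  move=> j; rewrite /wt inE; case: ifPn => [h|]; first by rewrite opprK lnK.
  by rewrite -leNgt => h; apply/le_anti; rewrite r0 h.
by rewrite e (eq_vmax e) r1 divr1.
Qed.

End Coordinates.

(** * The topology of Abar is Euclidean in the weights *)

Section CoordinateTopology.
Variables (R : realType) (n : nat).
Hypothesis n_gt0 : (0 < n)%N.
Implicit Types (p q : Abar R n) (I : {set 'I_n}) (z u c : 'I_n -> R).

Definition rc_open (S : Abar R n -> Prop) := forall p, S p ->
  exists2 e : R, 0 < e & forall q, (forall i, `|rc q i - rc p i| < e) -> S q.

Let setT_neq0 : [set: 'I_n]%SET != finset.set0.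
Proof. by apply/set0Pn; exists (Ordinal n_gt0); rewrite inE. Qed.

Lemma nrm_shiftE I z : exists m, forall i, i \in I -> nrm I z i = z i - m :> R.
Proof. by exists ((\sum_(j in I) z j) / #|I|%:R) => i iI; rewrite /nrm iI. Qed.

Lemma A_open_ball z0 d : A_open (fun z => @Apt R n z /\ forall i, `|z i - z0 i| < d).
Proof.
split=> [z []//|z [zA zd]]; have [e e0 he] := ball_radius zd.
by exists e => // z' z'A hz'; split => //; exact: he.
Qed.

Lemma A_bounded_ball z0 d : 0 < d ->
  A_bounded (fun z => @Apt R n z /\ forall i, `|z i - z0 i| < d).
Proof.
move=> d0; exists (d + vmax (fun i => `|z0 i|)) => z [_ h] i.
rewrite -[z i](subrK (z0 i)); apply: le_trans (ler_normD _ _) _.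
by rewrite lerD ?(ltW (h i))// (vmax_ub (fun i => `|z0 i|)).
Qed.

Lemma expR_near1 (e t : R) : 0 < e -> `|t| < ln (1 + e) -> `|expR t - 1| <= e.
Proof.
move=> e0 h; have e1 : 0 < 1 + e by lra.
have /andP[h1 h2] : - ln (1 + e) < t < ln (1 + e) by rewrite -ltr_norml.
have {}h2 : expR t < 1 + e by rewrite -(lnK (x := 1 + e)) ?posrE// ltr_expR.
have {}h1 : (1 + e)^-1 < expR t by rewrite -(lnK (x := 1 + e)) ?posrE// -expRN ltr_expR.
have h3 : 1 - e <= (1 + e)^-1.
  by rewrite -[_^-1]mul1r ler_pdivlMr//; nra.
by rewrite ler_norml; apply/andP; split; lra.
Qed.

Lemma Gamma_small p (e : R) : 0 < e -> exists U,
  [/\ A_open U, A_bounded U, Gamma (aI p) U p, (aI p = finset.setT -> U (az p)) &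
      forall q, Gamma (aI p) U q -> forall i, `|rc q i - rc p i| < e].
Proof.
move=> e0; pose I := aI p; pose w := wt I (az p); pose T0 := vmax w.
have T00 : 0 < T0 by apply: vmax_wt_gt0; exact: aI_neq0.
(* Weights are compared before normalization: an error e' = T0 * e4 in each of them costs 2 * e' /
   T0 = e / 2 afterwards. Within the radius [d] a weight changes by a factor that differs from 1 by
   at most [e4], and e^(-L) times the largest factor 1 + e4 is e'. *)
pose e4 := e / 4%:R; have e40 : 0 < e4 by rewrite /e4; lra.
pose e' := T0 * e4; have e'0 : 0 < e' by rewrite mulr_gt0.
pose d := ln (1 + e4); have d0 : 0 < d by apply: ln_gt0; lra.
have e4'0 : 0 < 1 + e4 by lra.
pose L := - ln (e' / (1 + e4)).
have LE : expR (- L) = e' / (1 + e4) by rewrite /L opprK lnK// posrE divr_gt0.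
pose zt i := if i \in I then az p i else L.
pose z0 := nrm finset.setT zt.
have [m hm] := nrm_shiftE finset.setT zt.
have {}hm i : z0 i = zt i - m by rewrite /z0 hm ?inE.
have zApt : Apt z0 by exact: normb_nrm.
have pz : az p = nrm I (fun i => z0 i + 0).
  rewrite -nrm_id; apply: (@nrm_shift _ _ _ _ _ m) => [|i iI]; first exact: aI_neq0.
  by rewrite hm /zt iI addr0 subrK.
exists (fun z => Apt z /\ forall i, `|z i - z0 i| < d); split.
- exact: A_open_ball.
- exact: A_bounded_ball.
- split; first exact: subxx.
  exists z0, (fun=> 0); split => //.
  by split => // i; rewrite subrr normr0.
- move=> IT; have -> : az p = z0.
    rewrite pz /I IT; under eq_fun do rewrite addr0.
    by apply: nrm_setT_id; apply/(Apt_sum _ n_gt0).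
  by split => // i; rewrite subrr normr0.
move=> q [IJ [u [c [[uA ud] c0 cI qz]]]] i.
(* The factor e^(-m) undoes the shift that brought [z0] to sum 0, so that [t] and [w] are on the
   same scale. *)
pose t j := expR (- m) * wt (aI q) (fun j => u j + c j) j.
have tE : rc q i = t i / vmax t.
  rewrite (rc_nrm _ qz) /t vmaxZ ?expR_ge0//.
  by rewrite -mulf_div divff ?mul1r// gt_eqF// expR_gt0.
have tw j : `|t j - w j| <= e'.
  have near1 : `|expR (z0 j - u j) - 1| <= e4.
    by apply: expR_near1 => //; rewrite distrC.
  rewrite /t /w /wt; have [jI|jI] := boolP (j \in I).
    rewrite (fintype.subsetP IJ _ jI) cI// addr0 -expRD.
    have -> : - m - u j = - az p j + (z0 j - u j) by rewrite hm /zt jI; ring.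
    rewrite expRD -{2}[expR (- az p j)]mulr1 -mulrBr normrM ger0_norm ?expR_ge0//.
    apply: ler_pM => //; rewrite ?expR_ge0//.
    by have := vmax_ub w j; rewrite /w /wt jI.
  rewrite subr0; case: ifP => _; last by rewrite mulr0 normr0 ltW.
  rewrite -expRD ger0_norm ?expR_ge0//.
  have -> : - m - (u j + c j) = - L + (z0 j - u j) + - c j.
    by rewrite hm /zt (negbTE jI); ring.
  have near2 : expR (z0 j - u j) <= 1 + e4.
    by move: near1; rewrite ler_norml => /andP[_]; lra.
  have c1 : expR (- c j) <= 1 by rewrite expR_le1 oppr_le0.
  rewrite 2!expRD LE -[leRHS]mulr1.
  apply: ler_pM c1; [|exact: expR_ge0|].
    by apply: mulr_ge0; [exact/ltW/divr_gt0|exact: expR_ge0].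
  by rewrite -mulrA (ler_piMr (ltW e'0))// ler_pdivrMl// mulr1.
rewrite tE /rc.
apply: le_lt_trans (_ : 2 * e' / T0 < _).
  apply: normalized_dist => //.
  - by rewrite mulr_ge0 ?expR_ge0 ?wt_ge0.
  - exact: vmax_ub.
  - by apply: vmax_dist => //; exact: ltW.
rewrite /e' [T0 * e4]mulrC mulrA mulfK ?gt_eqF// /e4; lra.
Qed.

Lemma rc_open_Abar_open S : rc_open S -> Abar_open S.
Proof.
move=> h p Sp; have [e e0 he] := h p Sp.
have [U [Uo Ub pU pT Us]] := Gamma_small p e0.
(* The base contains Gamma^I only for proper I; at points of A an open subset of A takes its
   place. *)
have [pIT|pIT] := eqVneq (aI p) finset.setT.
  exists (fun q => aI q = finset.setT /\ U (az q)); split.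
  - by left; exists U.
  - by split => //; exact: pT.
  move=> q [qT qU]; apply: he; apply: Us; split; first by rewrite pIT qT.
  exists (az q), (fun=> 0); split => //.
  by under eq_fun do rewrite addr0; rewrite nrm_id.
exists (Gamma (aI p) U); split => //.
  by right; exists (aI p), U; split => //; exact: aI_neq0.
by move=> q qU; apply: he; exact: Us.
Qed.

Lemma ln_near (r e : R) : 0 < r -> 0 < e -> exists2 d : R, 0 < d &
  forall t, `|t - r| < d -> 0 < t /\ `|ln t - ln r| < e.
Proof.
move=> r0 e0; pose a := expR (- e) : R; pose b := expR e : R.
have a1 : a < 1 by rewrite expR_lt1; lra.
have b1 : 1 < b by rewrite expR_gt1.
have a0 : 0 < a by exact: expR_gt0.
exists (Num.min (r * (1 - a)) (r * (b - 1))).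
  by rewrite lt_min !mulr_gt0// subr_gt0.
move=> t; rewrite lt_min => /andP[].
rewrite ltr_norml => /andP[h1 _]; rewrite ltr_norml => /andP[_ h2].
have h3 : r * a < t by lra.
have h4 : t < r * b by lra.
have ra0 : 0 < r * a by rewrite mulr_gt0.
have t0 : 0 < t by apply: lt_trans h3.
split => //.
have : ln (r * a) < ln t by rewrite ltr_ln ?posrE.
have : ln t < ln (r * b) by rewrite ltr_ln ?posrE// (lt_trans t0).
rewrite !lnM ?posrE ?expR_gt0// !expRK ltr_norml => k1 k2.
by apply/andP; split; lra.
Qed.

(** For [q] near [p], the coordinates that are finite at [p] change little, and the change is
    absorbed into [u]. Those that are infinite at [p] are infinite or large at [q], and in the
    second case their excess over [u] is a nonnegative coefficient in Delta_I. *)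
Lemma Gamma_rc_open I U : I != finset.set0 -> A_open U -> rc_open (Gamma I U).
Proof.
move=> I0 [UA Uo] p [IJ [u [c [Uu c0 cI pz]]]].
have [e e0 he] := Uo _ Uu.
pose J := aI p; pose V := vmax (wt J (fun i => u i + c i)); pose k := - ln V.
have V0 : 0 < V by apply: vmax_wt_gt0; exact: aI_neq0.
have pk i : i \in J -> u i + c i = - ln (rc p i) + k.
  move=> iJ; rewrite (rc_nrm _ pz) /wt -/J iJ ln_div ?posrE ?expR_gt0// expRK /k; ring.
(* Off J, the bound e^(k - u i) on the weight is exactly what makes the new coefficient -ln (rc q i)
   + k - u i nonnegative. *)
have [||d d0 hd] := @uniform_radius R n (fun i d => forall t, `|t - rc p i| < d ->
    if i \in J then 0 < t /\ `|ln t - ln (rc p i)| < e / 2 else t <= expR (k - u i)).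
- by move=> i a b ba h t ht; apply: h; apply: lt_le_trans ht ba.
- move=> i; have [iJ|iJ] := boolP (i \in J).
    by apply: ln_near; [rewrite rc_gt0|rewrite divr_gt0].
  exists (expR (k - u i)); first exact: expR_gt0.
  by move=> t; rewrite rc_eq0// subr0 => /(le_lt_trans (ler_norm _)) /ltW.
exists d => // q hq; pose J' := aI q.
have JJ' : J \subset J'.
  apply/fintype.subsetP => i iJ; rewrite -rc_gt0.
  by have := hd i _ (hq i); rewrite iJ => -[].
split; first exact: fintype.subset_trans IJ JJ'.
pose th i := if i \in J then - ln (rc q i) + ln (rc p i) else 0.
have thE i : `|th i| < e / 2.
  rewrite /th; case: ifP => iJ; last by rewrite normr0 divr_gt0.
  by have := hd i _ (hq i); rewrite iJ => -[_]; rewrite distrC addrC.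
pose m := (\sum_(j in finset.setT) (u j + th j)) / #|[set: 'I_n]%SET|%:R.
have nT0 : 0 < #|[set: 'I_n]%SET|%:R :> R by rewrite ltr0n card_gt0.
have mE : `|m| <= e / 2.
  have usum : \sum_(j in finset.setT) u j = 0.
    have /(Apt_sum _ n_gt0) h := UA _ Uu.
    by rewrite -[RHS]h; apply: eq_bigl => j; rewrite inE.
  rewrite /m big_split/= usum add0r normrM normfV (ger0_norm (ltW nT0)) ler_pdivrMr//.
  apply: le_trans (ler_norm_sum _ _ _) _.
  rewrite mulr_natr -sumr_const; apply: ler_sum => j _; exact: ltW.
pose u' := nrm finset.setT (fun i => u i + th i).
have u'E i : u' i = u i + th i - m by rewrite /u' /nrm inE.
pose c' i := if i \in J then c i else if i \in J' then - ln (rc q i) + k - u i else 0.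
exists u', c'; split.
- apply: he; first exact: normb_nrm.
  move=> i; rewrite u'E.
  have -> : u i + th i - m - u i = th i - m by ring.
  by apply: le_lt_trans (ler_normB _ _) _; have := thE i; lra.
- move=> i; rewrite /c'; case: ifP => // iJ; case: ifP => // iJ'.
  have := hd i _ (hq i); rewrite iJ => h.
  have : ln (rc q i) <= ln (expR (k - u i)) by rewrite ler_ln ?posrE ?expR_gt0 ?rc_gt0.
  by rewrite expRK; lra.
- by move=> i iI; rewrite /c' (fintype.subsetP IJ) ?cI.
rewrite az_rc; apply: (@nrm_shift _ _ _ _ _ (m - k)) => [|i iJ']; first exact: aI_neq0.
rewrite u'E /c' /th -/J'; case: ifP => iJ; last by rewrite iJ'; ring.
by have := pk _ iJ; lra.
Qed.

Lemma Abar_open_rc S : Abar_open S -> rc_open S.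
Proof.
move=> h p Sp; have [B [Bb Bp BS]] := h p Sp.
suff [e e0 he] : exists2 e : R, 0 < e &
    forall q, (forall i, `|rc q i - rc p i| < e) -> B q.
  by exists e => // q /he; exact: BS.
case: Bb => [[U [Uo BE]]|[I [U [I0 IT Uo _ BE]]]]; last first.
  have [e e0 he] := Gamma_rc_open I0 Uo ((BE p).1 Bp); exists e => // q hq.
  exact/BE/he.
(* For the full index set Delta_I is 0, so an open subset of A is also of the form [Gamma], and one
   lemma covers both kinds of base sets. *)
have GE q : B q <-> Gamma finset.setT U q.
  rewrite BE; split=> [[qT qU]|[qT [u [c [Uu c0 cI qz]]]]].
    split; first by rewrite qT.
    exists (az q), (fun=> 0); split => //.
    by under eq_fun do rewrite addr0; rewrite nrm_id.
  have {}qT : aI q = finset.setT by apply/eqP; rewrite finset.eqEsubset finset.subsetT.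
  split => //; rewrite qz qT; have -> : (fun i => u i + c i) = u.
    by apply/funext => i; rewrite cI ?inE// addr0.
  by rewrite nrm_setT_id//; apply/(Apt_sum _ n_gt0); case: Uo => + _; apply.
have [e e0 he] := Gamma_rc_open setT_neq0 Uo ((GE p).1 Bp).
exists e => // q hq; exact/GE/he.
Qed.

End CoordinateTopology.

(** * The function f_x and the root groups in terms of weights *)

Section RootFiltration.
Variables (K : fieldType) (v : K -> int) (R : realType) (n : nat).
Hypothesis Kloc : nonarch_local_field v.
Hypothesis n_gt0 : (0 < n)%N.
Local Notation abs := (absK v R).
Implicit Types (x y z : Abar R n) (i j k : 'I_n).

Lemma rc_halfspace z i j (t : R) : aI z = finset.setT ->
  (- t <= az z i - az z j) = (rc z i * expR (- t) <= rc z j).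
Proof.
move=> zT; have V0 := vmax_wt_gt0 (az z) (aI_neq0 z).
rewrite /rc mulrAC ler_pM2r ?invr_gt0// /wt zT !inE -expRD ler_expR.
by apply/idP/idP; lra.
Qed.

(** The inequality between weights passes to limits; conversely, a boundary point that satisfies it
    is approximated from A by giving small positive values to its zero weights. *)
Lemma closure_halfspace x i j (t : R) : i != j ->
  Abar_closure (fun z => aI z = finset.setT /\ - t <= az z i - az z j) x <->
  rc x i * expR (- t) <= rc x j.
Proof.
move=> ij; have s0 : 0 < expR (- t) by exact: expR_gt0.
set s := expR (- t) in s0 *; split.
  move=> cl; rewrite leNgt; apply/negP => lt.
  have [|z [/= zlt [zT]]] := cl (fun z => rc z j < rc z i * s) _ lt.
    apply: rc_open_Abar_open => // z zlt.
    pose d := (rc z i * s - rc z j) / (1 + s).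
    have d0 : 0 < d by rewrite divr_gt0 ?subr_gt0// addr_gt0.
    have dE : d * (1 + s) = rc z i * s - rc z j by rewrite divfK// gt_eqF// addr_gt0.
    exists d => // y h; have := h i; have := h j.
    rewrite !ltr_norml => /andP[_ h1] /andP[h2 _].
    have : (rc z i - d) * s < rc y i * s by rewrite ltr_pM2r//; lra.
    by lra.
  by rewrite rc_halfspace// -/s leNgt zlt.
move=> le O Oo Ox; have [e e0 he] := Abar_open_rc n_gt0 Oo Ox.
pose d := Num.min (e / 2) (1 / 2).
have d0 : 0 < d by rewrite lt_min; apply/andP; split; lra.
have d1 : d < 1 by rewrite gt_min; apply/orP; right; lra.
have de : d < e by rewrite gt_min; apply/orP; left; lra.
have s1 : 0 < Num.min 1 s^-1 by rewrite lt_min invr_gt0 s0 ltr01.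
(* Zero weights become [d], but if the weight of [x] at i is 0, the new weights satisfy r_i <= d / s
   and r_j >= d, so that r_i s <= d <= r_j. If it is positive, so is the one at j, and both are
   kept. As d < 1, the maximum remains 1. *)
pose r k := if (k == i) && (rc x i == 0) then d * Num.min 1 s^-1
            else if rc x k == 0 then d else Num.max (rc x k) (if (k == j) && (rc x i == 0) then d else 0).
have r0 k : 0 < r k.
  rewrite /r; case: ifP => _; first by rewrite mulr_gt0.
  case: ifP => // /negbT h; rewrite lt_max; apply/orP; left.
  by rewrite lt_def h rc_ge0.
have r1 k : r k <= 1.
  rewrite /r; case: ifP => _.
    by rewrite mulr_ile1 ?(ltW d0) ?(ltW d1) ?(ltW s1)// ge_min lexx.
  case: ifP => _; first exact: ltW.
  by rewrite ge_max rc_le1; case: ifP => _; rewrite ?ler01 ?(ltW d1).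
have rm : vmax r = 1.
  apply/le_anti/andP; split; first exact: vmax_le.
  have [k xk] := rc_max x; apply: le_trans (vmax_ub r k).
  rewrite /r; case: ifP => [/andP[/eqP ki /eqP xi]|_].
    by move: xk; rewrite ki xi => /eqP; rewrite eq_sym oner_eq0.
  by rewrite xk oner_eq0 le_max lexx.
have [z zr] := rc_surj (fun k => ltW (r0 k)) rm.
have zT : aI z = finset.setT by apply/setP => k; rewrite inE -rc_gt0 zr r0.
exists z; split.
  apply: he => k; rewrite zr /r; case: ifP => [/andP[/eqP -> /eqP ->]|h].
    rewrite subr0 gtr0_norm ?mulr_gt0//; apply: le_lt_trans de.
    by rewrite ler_piMr ?(ltW d0)// ge_min lexx.
  have [->|xk] := eqVneq (rc x k) 0; first by rewrite subr0 gtr0_norm.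
  have xk0 := rc_ge0 x k.
  case: ifP => [_|_]; last by rewrite max_l// subrr normr0.
  by rewrite /Num.max; case: ifP => [h2|_]; rewrite ?subrr ?normr0// ger0_norm; lra.
have ji : (j == i) = false by rewrite eq_sym (negbTE ij).
split => //; rewrite rc_halfspace// -/s !zr /r !eqxx ji (negbTE ij) /=.
have [xi|xi] := eqVneq (rc x i) 0.
  apply: (@le_trans _ _ d).
    rewrite -mulrA ler_piMr ?(ltW d0)//.
    apply: (@le_trans _ _ (s^-1 * s)); last by rewrite mulVf// gt_eqF.
    by rewrite ler_pM2r// ge_min lexx orbT.
  by case: ifP => // _; rewrite le_max lexx orbT.
have xi0 : 0 < rc x i by rewrite lt_def xi rc_ge0.
have xj0 : 0 < rc x j by apply: lt_le_trans le; rewrite mulr_gt0.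
by rewrite (gt_eqF xj0) /= !max_l ?(ltW xi0) ?(ltW xj0).
Qed.

(** The condition r_i e^(-t) <= r_j is closed in t, so the infimum f_x is attained when finite. If
    r_i |u| > r_j, an intermediate value [m] separates v(u) from the infimum; [m] is positive even
    if r_j = 0, where f_x is infinite. *)
Lemma fx_le x i j (u : K) : i != j ->
  (fx x i j <= vE v R u)%E <-> rc x i * abs u <= rc x j.
Proof.
move=> ij; rewrite /vE /absK; have [_|u0] := eqVneq u 0.
  by rewrite leey mulr0 rc_ge0.
set w : R := (v u)%:~R.
pose T := [set t : R | Abar_closure (fun z => aI z = finset.setT /\ - t <= az z i - az z j) x]%classic.
have TE t : T t <-> rc x i * expR (- t) <= rc x j by exact: closure_halfspace.
split; last by move=> h; apply: ereal_inf_lbound; exists w => //; apply/TE.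
move=> le; rewrite leNgt; apply/negP => lt.
have xj := rc_ge0 x j.
have xi : 0 < rc x i.
  by have := le_lt_trans xj lt; rewrite pmulr_lgt0// expR_gt0.
pose m := (rc x j + rc x i * expR (- w)) / 2.
have m0 : 0 < m by rewrite /m; lra.
pose s := - ln (m / rc x i).
have sE : rc x i * expR (- s) = m.
  rewrite /s opprK lnK; last by rewrite posrE divr_gt0.
  by rewrite [LHS]mulrC divfK ?gt_eqF.
have ws : w < s.
  have : rc x i * expR (- s) < rc x i * expR (- w) by rewrite sE /m; lra.
  by rewrite ltr_pM2l// ltr_expR; lra.
have : (s%:E <= fx x i j)%E.
  apply: le_ereal_inf_tmp => _ [t /TE ht <-]; rewrite lee_fin.
  have : rc x i * expR (- t) < rc x i * expR (- s) by rewrite sE /m; lra.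
  by rewrite ltr_pM2l// ltr_expR; lra.
by move=> /le_trans /(_ le); rewrite lee_fin leNgt ws.
Qed.

(** Arbitrary weights let one elimination serve U_x and U_y as well as U_0, where all weights are
    1. *)
Definition elementary (r : 'I_n -> R) (M : 'M[K]_n) := exists i j u,
  [/\ i != j, r i * abs u <= r j & M = 1%:M + u *: delta_mx i j].

Lemma Uij_genE x : @Uij_gen K v R n x = elementary (rc x).
Proof.
apply/funext => M; apply/propext; split=> -[i [j [u [ij h ->]]]]; exists i, j, u.
  by split => //; apply/fx_le.
by split => //; apply/fx_le.
Qed.

Lemma rc_origin x i : is_origin x -> rc x i = 1.
Proof.
case=> xT x0; have [k xk] := rc_max x; rewrite -xk /rc.
by rewrite /wt xT x0 !inE.
Qed.

Lemma exists_origin : exists x, is_origin x.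
Proof.
have T0 : [set: 'I_n]%SET != finset.set0 by apply/set0Pn; exists (Ordinal n_gt0); rewrite inE.
have [p [pT pz]] := exists_point (fun=> 0 : R) T0.
exists p; split => //; rewrite pz nrm_setT_id//.
by rewrite big1.
Qed.

End RootFiltration.

(** * Gaussian elimination with weighted pivots *)

Section Elimination.
Variables (K : fieldType) (v : K -> int) (R : realType) (n : nat).
Hypothesis Kloc : nonarch_local_field v.
Local Notation abs := (absK v R).
Implicit Types (r s : 'I_n -> R) (M X : 'M[K]_n) (i j : 'I_n).

Lemma gen_grp_mul (S : 'M[K]_n -> Prop) A B :
  gen_grp S A -> gen_grp S B -> gen_grp S (A *m B).
Proof.
move=> + hB; elim=> [|a b Sa _ IH|a b Sa ua _ IH]; first by rewrite mul1mx.
  by rewrite -mulmxA; exact: (Defs.genM Sa IH).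
by rewrite -mulmxA; exact: (Defs.genV Sa ua IH).
Qed.

Lemma gen_grp1 (S : 'M[K]_n -> Prop) A : S A -> gen_grp S A.
Proof. by move=> SA; rewrite -[A]mulmx1; apply: Defs.genM => //; exact: Defs.gen1. Qed.

Lemma mul_elementary i j (u w : K) : i != j ->
  (1%:M + u *: delta_mx i j) *m (1%:M + w *: delta_mx i j) =
  1%:M + (u + w) *: delta_mx i j :> 'M_n.
Proof.
move=> ij; rewrite mulmxDl mul1mx mulmxDr mulmx1 -scalemxAl -scalemxAr.
rewrite mul_delta_mx_0; last by rewrite eq_sym.
by rewrite !scaler0 addr0 scalerDl -addrA [w *: _ + _]addrC.
Qed.

Lemma elementary_unit i j (u : K) : i != j -> 1%:M + u *: delta_mx i j \in unitmx.
Proof.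
move=> ij; have := mul_elementary u (- u) ij; rewrite subrr scale0r addr0.
by case/mulmx1_unit.
Qed.

Definition col_transvection i0 (l : 'I_n -> K) : 'M[K]_n :=
  \matrix_(a, b) (if (a != i0) && (b == i0) then l a else 0).

Definition row_transvection j0 (l : 'I_n -> K) : 'M[K]_n :=
  \matrix_(a, b) (if (b != j0) && (a == j0) then l b else 0).

Lemma col_transvectionE i0 l :
  col_transvection i0 l = \sum_(i | i != i0) l i *: delta_mx i i0.
Proof.
apply/matrixP => a b; rewrite summxE mxE.
have [->|ai] := eqVneq a i0.
  by rewrite big1//= => i ii0; rewrite !mxE eq_sym (negbTE ii0) mulr0.
rewrite (bigD1 a)//= big1 => [|i /andP[_ ia]]; last first.
  by rewrite !mxE eq_sym (negbTE ia) mulr0.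
by rewrite !mxE eqxx addr0; case: eqVneq => _; rewrite ?mulr1 ?mulr0.
Qed.

Lemma row_transvectionE j0 l :
  row_transvection j0 l = \sum_(j | j != j0) l j *: delta_mx j0 j.
Proof.
apply/matrixP => a b; rewrite summxE mxE.
have [->|bj] := eqVneq b j0.
  by rewrite big1//= => i ii0; rewrite !mxE [j0 == i]eq_sym (negbTE ii0) andbF mulr0.
rewrite (bigD1 b)//= big1 => [|i /andP[_ ib]]; last first.
  by rewrite !mxE [b == i]eq_sym (negbTE ib) andbF mulr0.
by rewrite !mxE eqxx andbT addr0; case: eqVneq => _; rewrite ?mulr1 ?mulr0.
Qed.

Lemma gen_col_transvection r i0 l : (forall i, i != i0 -> r i * abs (l i) <= r i0) ->
  gen_grp (elementary v r) (1%:M + col_transvection i0 l).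
Proof.
move=> h; rewrite col_transvectionE; elim: (index_enum _) => [|i q IH].
  by rewrite big_nil addr0; exact: Defs.gen1.
rewrite big_cons; case: ifP => // ii0.
suff -> : 1%:M + (l i *: delta_mx i i0 + \sum_(j <- q | j != i0) l j *: delta_mx j i0) =
    (1%:M + l i *: delta_mx i i0) *m (1%:M + \sum_(j <- q | j != i0) l j *: delta_mx j i0).
  by apply: Defs.genM => //; exists i, i0, (l i); split => //; exact: h.
have z : l i *: delta_mx i i0 *m (\sum_(j <- q | j != i0) l j *: delta_mx j i0) = 0 :> 'M_n.
  rewrite mulmx_sumr big1// => j ji0.
  by rewrite -scalemxAl -scalemxAr mul_delta_mx_0 ?scaler0// eq_sym.
by rewrite mulmxDl mul1mx mulmxDr mulmx1 z addr0 [l i *: _ + _]addrC addrA.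
Qed.

Lemma gen_row_transvection r j0 l : (forall j, j != j0 -> r j0 * abs (l j) <= r j) ->
  gen_grp (elementary v r) (1%:M + row_transvection j0 l).
Proof.
move=> h; rewrite row_transvectionE; elim: (index_enum _) => [|j q IH].
  by rewrite big_nil addr0; exact: Defs.gen1.
rewrite big_cons; case: ifP => // jj0.
suff -> : 1%:M + (l j *: delta_mx j0 j + \sum_(k <- q | k != j0) l k *: delta_mx j0 k) =
    (1%:M + l j *: delta_mx j0 j) *m (1%:M + \sum_(k <- q | k != j0) l k *: delta_mx j0 k).
  by apply: Defs.genM => //; exists j0, j, (l j); split => //; [rewrite eq_sym|exact: h].
have z : l j *: delta_mx j0 j *m (\sum_(k <- q | k != j0) l k *: delta_mx j0 k) = 0 :> 'M_n.
  rewrite mulmx_sumr big1// => k kj0.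
  by rewrite -scalemxAl -scalemxAr mul_delta_mx_0 ?scaler0.
by rewrite mulmxDl mul1mx mulmxDr mulmx1 z addr0 [l j *: _ + _]addrC addrA.
Qed.

Lemma mul_col_transvection i0 l X a b :
  ((1%:M + col_transvection i0 l) *m X) a b =
  X a b + (if a != i0 then l a * X i0 b else 0).
Proof.
rewrite mulmxDl mul1mx mxE; congr (_ + _); rewrite mxE.
rewrite (bigD1 i0)//= big1 => [|k ki0]; last by rewrite mxE (negbTE ki0) andbF mul0r.
by rewrite mxE eqxx andbT addr0; case: ifP => _; rewrite ?mul0r.
Qed.

Lemma mul_row_transvection j0 l X a b :
  (X *m (1%:M + row_transvection j0 l)) a b =
  X a b + (if b != j0 then X a j0 * l b else 0).
Proof.
rewrite mulmxDr mulmx1 mxE; congr (_ + _); rewrite mxE.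
rewrite (bigD1 j0)//= big1 => [|k kj0]; last by rewrite mxE (negbTE kj0) andbF mulr0.
by rewrite mxE eqxx andbT addr0; case: ifP => _; rewrite ?mulr0.
Qed.

(** The Schur complement of the entry (i0, j0), kept at full size with the pivot in place, which
    avoids reindexing rows and columns. *)
Definition schur M i0 j0 : 'M[K]_n := \matrix_(i, j)
  if i == i0 then (if j == j0 then M i0 j0 else 0)
  else if j == j0 then 0 else M i j - M i j0 / M i0 j0 * M i0 j.

Lemma schur_step r s M i0 j0 : M i0 j0 != 0 ->
  (forall i, r i * abs (M i j0) <= r i0 * abs (M i0 j0)) ->
  (forall j, s j0 * abs (M i0 j) <= s j * abs (M i0 j0)) ->
  exists A B, [/\ gen_grp (elementary v r) A, gen_grp (elementary v s) B &
                  M = A *m schur M i0 j0 *m B].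
Proof.
move=> p0 hr hs; have ap0 : 0 < abs (M i0 j0) by rewrite absK_gt0.
exists (1%:M + col_transvection i0 (fun i => M i j0 / M i0 j0)).
exists (1%:M + row_transvection j0 (fun j => M i0 j / M i0 j0)); split.
- by apply: gen_col_transvection => i _; rewrite absKM// absKV// mulrA ler_pdivrMr.
- by apply: gen_row_transvection => j _; rewrite absKM// absKV// mulrA ler_pdivrMr.
apply/matrixP => a b; rewrite mul_row_transvection !mul_col_transvection !mxE !eqxx.
have [->|ai] := eqVneq a i0; have [->|bj] := eqVneq b j0; rewrite /= ?addr0 ?add0r ?eqxx //.
- by field.
- by field.
- by field.
Qed.

(** For positive weights, an entry maximizing r_i |M_ij| / s_j satisfies both bounds. If a nonzero
    entry lies in a column with s_j = 0, the row bound is automatic there and only the column is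
    maximized. If the maximal quotient is reached with r_i = 0, it is 0, so all nonzero entries
    outside D lie in rows of weight 0; then the column bound is automatic and |M_ij| / s_j is
    maximized along the row. *)
Lemma exists_pivot r s (D : {set 'I_n}) M i1 j1 :
  (forall i, 0 <= r i) -> (forall j, 0 <= s j) -> i1 \notin D -> M i1 j1 != 0 ->
  exists i0 j0, [/\ i0 \notin D, M i0 j0 != 0,
    forall i, i \notin D -> r i * abs (M i j0) <= r i0 * abs (M i0 j0) &
    forall j, s j0 * abs (M i0 j) <= s j * abs (M i0 j0)].
Proof.
move=> r0 s0 i1D M1.
pose P (e : 'I_n * 'I_n) := (e.1 \notin D) && (M e.1 e.2 != 0).
have P1 : P (i1, j1) by rewrite /P i1D.
have [[[i2 j2] /= [/andP[/= i2D M2] sj2]]|hs] := pselect (exists e, P e /\ s e.2 = 0).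
  have Q2 : (i2 \notin D) && (M i2 j2 != 0) by rewrite i2D.
  case: (@Order.TotalTheory.arg_maxP _ _ _ i2 (fun i => (i \notin D) && (M i j2 != 0))
    (fun i => r i * abs (M i j2)) Q2) => i0 /andP[i0D M0] hmax.
  exists i0, j2; split => // [i iD|j].
    have [->|Mi] := eqVneq (M i j2) 0; last by apply: hmax; rewrite iD.
    by rewrite absK0 mulr0 mulr_ge0 ?absK_ge0.
  by rewrite sj2 mul0r mulr_ge0 ?absK_ge0.
have {}hs e : P e -> 0 < s e.2.
  by move=> Pe; rewrite lt_def s0 andbT; apply/eqP => se; apply: hs; exists e.
case: (@Order.TotalTheory.arg_maxP _ _ _ (i1, j1) P
    (fun e => r e.1 * abs (M e.1 e.2) / s e.2) P1) => -[i0 j0] P0 hmax.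
have /= sj0 := hs _ P0; have /andP[/= i0D M0] := P0.
have aM0 : 0 < abs (M i0 j0) by rewrite absK_gt0.
have [ri0|ri0] := eqVneq (r i0) 0.
  have rz e : P e -> r e.1 = 0.
    move=> Pe; have := hmax _ Pe; rewrite /= ri0 !mul0r => h.
    have /andP[_ Me] := Pe; have ae : 0 < abs (M e.1 e.2) by rewrite absK_gt0.
    by apply/le_anti; rewrite r0 andbT; move: h; rewrite pmulr_lle0 ?invr_gt0 ?hs// pmulr_lle0.
  case: (@Order.TotalTheory.arg_maxP _ _ _ j0 (fun j => M i0 j != 0)
    (fun j => abs (M i0 j) / s j) M0) => j3 M3 hmax3.
  exists i0, j3; split => // [i iD|j].
    have [->|Mi] := eqVneq (M i j3) 0.
      by rewrite absK0 mulr0 mulr_ge0 ?absK_ge0.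
    have /= -> := rz (i, j3); last by rewrite /P /= iD.
    by rewrite mul0r mulr_ge0 ?absK_ge0.
  have [->|Mj] := eqVneq (M i0 j) 0; first by rewrite absK0 mulr0 mulr_ge0 ?absK_ge0.
  have /= sj : 0 < s (i0, j).2 by apply: hs; rewrite /P /= i0D.
  have /= sj3 : 0 < s (i0, j3).2 by apply: hs; rewrite /P /= i0D.
  have /= := hmax3 _ Mj; rewrite ler_pdivrMr// mulrAC ler_pdivlMr//.
  by rewrite mulrC [s j * _]mulrC.
have ri0' : 0 < r i0 by rewrite lt_def ri0 r0.
exists i0, j0; split => // [i iD|j].
  have [->|Mi] := eqVneq (M i j0) 0; first by rewrite absK0 mulr0 mulr_ge0 ?absK_ge0.
  have := hmax (i, j0); rewrite /P /= iD Mi => /(_ isT).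
  by rewrite ler_pM2r// invr_gt0.
have [->|Mj] := eqVneq (M i0 j) 0; first by rewrite absK0 mulr0 mulr_ge0 ?absK_ge0.
have Pj : P (i0, j) by rewrite /P /= i0D.
have /= sj := hs _ Pj; have /= := hmax _ Pj.
rewrite -!mulrA ler_pM2l// ler_pdivrMr// mulrAC ler_pdivlMr//.
by rewrite mulrC [s j * _]mulrC.
Qed.

(** Elimination is finished in such a row. The induction runs over the number of rows outside a set
    D of isolated rows; the columns already used are remembered only through this property. *)
Definition isolated M i := exists j, [/\ M i j != 0,
  forall i', i' != i -> M i' j = 0 & forall j', j' != j -> M i j' = 0].

Lemma schur_isolated M i0 j0 i : M i0 j0 != 0 -> i != i0 -> isolated M i ->
  M i j0 = 0 /\ isolated (schur M i0 j0) i.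
Proof.
move=> p0 ii0 [j [Mij cj ri]].
have jj0 : j0 != j by apply: contra_neq p0 => ->; rewrite cj// eq_sym.
have Mi0 : M i j0 = 0 by exact: ri.
split => //; exists j; split.
- by rewrite mxE (negbTE ii0) [j == j0]eq_sym (negbTE jj0) Mi0 !mul0r subr0.
- move=> i' i'i; rewrite mxE [j == j0]eq_sym (negbTE jj0) [M i0 j]cj 1?eq_sym//.
  by case: ifP => // _; rewrite mulr0 subr0 cj.
- move=> j' j'j; rewrite mxE (negbTE ii0) Mi0 !mul0r subr0 ri//.
  by case: ifP.
Qed.

Lemma all_isolated_monomial M : (forall i, isolated M i) -> N_mat M.
Proof.
move=> h; have [s hs] := choice h.
have s_inj : injective s.
  move=> i k e; apply/eqP; apply: contraT => ik.
  have [_ ci _] := hs i; have [Mk _ _] := hs k.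
  by move: Mk; rewrite -e ci ?eqxx// eq_sym.
(* [s] sends a row to its column, while [permK w] has its entries at (w j, j); hence the inverse. *)
exists (fun i => M i (s i)), ((perm s_inj)^-1)%g; split.
  by move=> i; case: (hs i).
apply/matrixP => i j; rewrite mxE (bigD1 i)//= big1 ?addr0 => [|k ki]; last first.
  by rewrite mxE eq_sym (negbTE ki) mul0r.
rewrite !mxE eqxx; have -> : (i == ((perm s_inj)^-1)%g j) = (s i == j).
  by rewrite -(inj_eq (@perm_inj _ (perm s_inj))) permKV permE.
have [<-|sij] := eqVneq (s i) j; first by rewrite mulr1.
by rewrite mulr0; case: (hs i) => _ _; apply; rewrite eq_sym.
Qed.

(* Gaussian elimination whose pivots maximize r_i |M_ij| in their column and
   |M_ij| / s_j in their row, so that the elementary factors satisfy the bounds. *)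
Lemma bruhat_decomposition r s M : (forall i, 0 <= r i) -> (forall j, 0 <= s j) ->
  M \in unitmx -> exists A C B, [/\ gen_grp (elementary v r) A, N_mat C,
    gen_grp (elementary v s) B & M = A *m C *m B].
Proof.
move=> r0 s0.
suff H m (D : {set 'I_n}) X : #|~: D| = m -> (forall i, i \in D -> isolated X i) ->
    X \in unitmx -> exists A C B, [/\ gen_grp (elementary v r) A, N_mat C,
    gen_grp (elementary v s) B & X = A *m C *m B].
  by apply: (H _ finset.set0) => // i; rewrite inE.
elim: m D X => [|m IH] D X.
  move/eqP; rewrite cards_eq0 => /eqP DT hD _; exists 1%:M, X, 1%:M; split; try exact: Defs.gen1.
    apply: all_isolated_monomial => i; apply: hD.
    have : i \notin ~: D by rewrite DT inE.
    by rewrite inE negbK.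
  by rewrite mul1mx mulmx1.
move=> Dm hD Xu.
have /card_gt0P[i1 i1D] : (0 < #|~: D|)%N by rewrite Dm.
have [j1 X1] : exists j, X i1 j != 0.
  apply: contrapT => h; have row0 : row i1 X = 0.
    by apply/rowP => j; rewrite !mxE; apply/eqP; apply: contraT => hj; case: h; exists j.
  have : row i1 X *m invmx X = row i1 1%:M by rewrite -row_mul mulmxV.
  by rewrite row0 mul0mx => /rowP /(_ i1); rewrite !mxE eqxx => /eqP; rewrite eq_sym oner_eq0.
move: i1D; rewrite inE => i1D.
have [i0 [j0 [i0D X0 hr hs]]] := exists_pivot r0 s0 i1D X1.
have iD i : i \in D -> i != i0 by apply: contraTneq => ->.
have [|A [B [hA hB XE]]] := @schur_step r s X i0 j0 X0 _ hs.
  move=> i; have [iD'|] := boolP (i \in D); last exact: hr.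
  have [-> _] := schur_isolated X0 (iD i iD') (hD i iD').
  by rewrite absK0 mulr0 mulr_ge0 ?absK_ge0.
have Su : schur X i0 j0 \in unitmx.
  by move: Xu; rewrite {1}XE !unitmx_mul => /andP[/andP[]].
have [||//|A' [C [B' [hA' hC hB' SE]]]] := IH (i0 |: D) (schur X i0 j0).
- have -> : ~: (i0 |: D) = ~: D :\ i0 by apply/setP => k; rewrite !inE negb_or.
  by have := cardsD1 i0 (~: D); rewrite Dm inE i0D add1n => -[].
- move=> i; rewrite !inE => /orP[/eqP ->|iD']; last first.
    by case: (schur_isolated X0 (iD i iD') (hD i iD')).
  exists j0; split; first by rewrite mxE !eqxx.
  - by move=> i' /negbTE i'0; rewrite mxE i'0 eqxx.
  - by move=> j' /negbTE j'0; rewrite mxE eqxx j'0.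
exists (A *m A'), C, (B' *m B); split; try exact: gen_grp_mul; first exact: hC.
by rewrite XE SE !mulmxA.
Qed.

End Elimination.

(** * Equality of classes in a quotient *)

Section Quotients.
Variables (T : Type) (Rl : T -> T -> Prop).

Lemma qproj_inj x y : Rl y y -> qproj Rl x = qproj Rl y -> Rl x y.
Proof. by move=> yy /(congr1 (@proj1_sig _ _)) /= ->. Qed.

Lemma eq_qproj x y : (forall a b, Rl a b -> Rl b a) ->
  (forall a b c, Rl a b -> Rl b c -> Rl a c) -> Rl x y -> qproj Rl x = qproj Rl y.
Proof.
move=> sym tr xy; apply: eq_exist; apply/funext => z; apply/propext; split.
  by apply: tr; exact: sym.
exact: tr.
Qed.

Lemma qproj_surj (z : quot Rl) : exists x, z = qproj Rl x.
Proof. by case: z => C [x Cx]; exists x; exact: eq_exist. Qed.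

End Quotients.

(** * Seminorms, the action of N, and P_x as a stabilizer *)

Section Seminorms.
Variables (K : fieldType) (v : K -> int) (R : realType) (n : nat).
Hypothesis Kloc : nonarch_local_field v.
Hypothesis n_gt0 : (0 < n)%N.
Local Notation abs := (absK v R).
Implicit Types (r s t : 'I_n -> R) (M A B C : 'M[K]_n) (i j : 'I_n) (a b : 'cV[K]_n).
Implicit Types (x y : Abar R n).

Definition seminorm r a : R := vmax (fun i => r i * abs (a i 0)).

Lemma seminorm_ge0 r a : 0 <= seminorm r a. Proof. exact: vmax_ge0. Qed.

Lemma seminorm_ub r a i : r i * abs (a i 0) <= seminorm r a.
Proof. exact: (vmax_ub (fun i => r i * abs (a i 0))). Qed.

Lemma seminorm0 r : seminorm r 0 = 0.
Proof.
apply/le_anti; rewrite seminorm_ge0 andbT; apply: vmax_le => // i.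
by rewrite mxE absK0 mulr0.
Qed.

Lemma seminormZ r (k : K) a : seminorm r (k *: a) = abs k * seminorm r a.
Proof.
rewrite /seminorm -vmaxZ ?absK_ge0//; apply: eq_vmax => i.
by rewrite mxE absKM// mulrCA.
Qed.

Lemma seminormN r a : seminorm r (- a) = seminorm r a.
Proof. by apply: eq_vmax => i; rewrite mxE absKN. Qed.

Lemma seminormD r a b c : (forall i, 0 <= r i) -> seminorm r a <= c -> seminorm r b <= c ->
  seminorm r (a + b) <= c.
Proof.
move=> r0 ha hb; apply: vmax_le => [|i]; first exact: le_trans (seminorm_ge0 r a) ha.
rewrite mxE; have [e|ri] := eqVneq (r i) 0.
  by rewrite e mul0r; apply: le_trans ha; exact: seminorm_ge0.
have ri0 : 0 < r i by rewrite lt_def ri r0.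
rewrite -ler_pdivlMl//; apply: absKD => //; rewrite ler_pdivlMl//.
  by apply: le_trans ha; exact: seminorm_ub.
by apply: le_trans hb; exact: seminorm_ub.
Qed.

Lemma seminorm_delta r j : (forall i, 0 <= r i) -> seminorm r (delta_mx j 0) = r j.
Proof.
move=> r0; apply/le_anti/andP; split.
  apply: vmax_le => // i; rewrite mxE eqxx andbT; have [->|_] := eqVneq i j.
    by rewrite absK1// mulr1.
  by rewrite absK0 mulr0.
by have := seminorm_ub r (delta_mx j 0) j; rewrite mxE !eqxx absK1// mulr1.
Qed.

Definition preserves r M := forall a, seminorm r (M *m a) = seminorm r a.

(** As matrices act on seminorms by composition with the inverse, this says that [M] carries the
    homothety class given by [r] to the one given by [s]. *)
Definition scales r s M := exists2 c : R, 0 < c & forall a, seminorm s (M *m a) = c * seminorm r a.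

Lemma preserves_scales r M : preserves r M -> scales r r M.
Proof. by move=> h; exists 1 => // a; rewrite h mul1r. Qed.

Lemma preserves1 r : preserves r 1%:M. Proof. by move=> a; rewrite mul1mx. Qed.

Lemma preservesM r A B : preserves r A -> preserves r B -> preserves r (A *m B).
Proof. by move=> hA hB a; rewrite -mulmxA hA hB. Qed.

Lemma preservesV r A : A \in unitmx -> preserves r A -> preserves r (invmx A).
Proof. by move=> uA hA a; rewrite -hA mulKVmx. Qed.

Lemma scalesM r s t A B : scales r s A -> scales s t B -> scales r t (B *m A).
Proof.
move=> [c c0 hA] [d d0 hB]; exists (d * c); first exact: mulr_gt0.
by move=> a; rewrite -mulmxA hB hA mulrA.
Qed.

Lemma scalesV r s A : A \in unitmx -> scales r s A -> scales s r (invmx A).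
Proof.
move=> uA [c c0 hA]; exists c^-1; first by rewrite invr_gt0.
move=> a; rewrite -{2}(mulKVmx uA a) hA mulKf// gt_eqF//.
Qed.

Lemma scalesZ r s A (k : K) : k != 0 -> scales r s A -> scales r s (k *: A).
Proof.
move=> k0 [c c0 hA]; exists (abs k * c); first by rewrite mulr_gt0// absK_gt0.
by move=> a; rewrite -scalemxAl seminormZ hA mulrA.
Qed.

Lemma scales1_eq x y : scales (rc x) (rc y) 1%:M -> y = x.
Proof.
move=> [c _ h]; apply: (@rc_inj _ _ _ _ c) => i.
have := h (delta_mx i 0); rewrite mul1mx !seminorm_delta//; exact: rc_ge0.
Qed.

(** One inequality for all admissible coefficients is enough: the inverse has coefficient -u, of the
    same absolute value. *)
Lemma elementary_preserves r M : (forall i, 0 <= r i) -> elementary v r M -> preserves r M.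
Proof.
move=> r0 [i [j [u [ij h ->]]]].
have le (w : K) a : r i * abs w <= r j -> seminorm r ((1%:M + w *: delta_mx i j) *m a) <= seminorm r a.
  move=> hw; rewrite mulmxDl mul1mx -scalemxAl; apply: seminormD => //.
  apply: vmax_le => [|k]; first exact: seminorm_ge0.
  rewrite !mxE (bigD1 j)//= big1 ?addr0 => [|l lj]; last first.
    by rewrite mxE (negbTE lj) andbF mul0r.
  rewrite mxE eqxx andbT; have [->|_] := eqVneq k i; last first.
    by rewrite mul0r mulr0 absK0 mulr0 seminorm_ge0.
  rewrite mul1r absKM// mulrA; apply: le_trans (seminorm_ub r a j).
  by apply: ler_wpM2r => //; exact: absK_ge0.
move=> a; apply/le_anti/andP; split; first exact: le.
have {1}-> : a = (1%:M + (- u) *: delta_mx i j) *m ((1%:M + u *: delta_mx i j) *m a).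
  by rewrite mulmxA mul_elementary// addNr scale0r addr0 mul1mx.
by apply: le; rewrite absKN.
Qed.

Lemma elementary_unitmx r M : elementary v r M -> M \in unitmx.
Proof. by move=> [i [j [u [ij _ ->]]]]; exact: elementary_unit. Qed.

Lemma gen_elementary_preserves r M : (forall i, 0 <= r i) ->
  gen_grp (elementary v r) M -> M \in unitmx /\ preserves r M.
Proof.
move=> r0; elim=> [|A B hA _ [uB iB]|A B hA _ _ [uB iB]].
- by split; [exact: unitmx1|exact: preserves1].
- by rewrite unitmx_mul (elementary_unitmx hA) uB; split => //; apply: preservesM => //; apply: elementary_preserves.
- have uA := elementary_unitmx hA.
  rewrite unitmx_mul unitmx_inv uA uB; split => //.
  by apply: preservesM => //; apply: preservesV => //; apply: elementary_preserves.
Qed.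

Definition monomial (d : 'I_n -> K) (w : 'S_n) := diagK d *m @Defs.permK K n w.

Lemma monomialE d w i j : monomial d w i j = if i == w j then d i else 0.
Proof.
rewrite mxE (bigD1 i)//= big1 ?addr0 => [|k ki]; last first.
  by rewrite mxE eq_sym (negbTE ki) mul0r.
by rewrite !mxE eqxx; case: ifP; rewrite ?mulr1 ?mulr0.
Qed.

Lemma diagK_monomial d : diagK d = monomial d 1%g.
Proof. by apply/matrixP => i j; rewrite monomialE !mxE perm1. Qed.

Lemma monomial_mul d w a i : (monomial d w *m a) (w i) 0 = d (w i) * a i 0.
Proof.
rewrite mxE (bigD1 i)//= monomialE eqxx big1 ?addr0// => k ki.
by rewrite monomialE (inj_eq perm_inj) eq_sym (negbTE ki) mul0r.
Qed.

Lemma seminorm_monomial r d w a :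
  seminorm r (monomial d w *m a) = seminorm (fun i => r (w i) * abs (d (w i))) a.
Proof.
have e i : r (w i) * abs ((monomial d w *m a) (w i) 0) = r (w i) * abs (d (w i)) * abs (a i 0).
  by rewrite monomial_mul absKM// mulrA.
apply/le_anti/andP; split; apply: vmax_le => [|i]; try exact: seminorm_ge0.
  by rewrite -[i](permKV w) e (seminorm_ub (fun i => r (w i) * abs (d (w i)))).
by rewrite -e seminorm_ub.
Qed.

Lemma monomial_unit d w : (forall i, d i != 0) -> monomial d w \in unitmx.
Proof.
move=> d0; suff : monomial d w *m monomial (fun i => (d (w i))^-1) (w^-1)%g = 1%:M.
  by case/mulmx1_unit.
apply/matrixP => i j; rewrite mxE (bigD1 (w^-1 i)%g)//= big1 ?addr0 => [|k ki]; last first.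
  rewrite monomialE ifF ?mul0r//; apply/eqP => e; move: ki.
  by rewrite e permK eqxx.
rewrite !monomialE permKV eqxx (inj_eq perm_inj) !mxE.
by case: eqP => // _; rewrite ?divff ?mulr0.
Qed.

Lemma N_mat_unit C : N_mat C -> C \in unitmx.
Proof. by move=> [d [w [d0 ->]]]; exact: monomial_unit. Qed.

Lemma scales_monomial x y d w :
  scales (rc x) (rc y) (monomial d w) <->
  exists2 c : R, 0 < c & forall i, rc y (w i) * abs (d (w i)) = c * rc x i.
Proof.
split=> -[c c0 h]; exists c => //; [move=> i|move=> a].
  have := h (delta_mx i 0); rewrite seminorm_monomial !seminorm_delta// => j.
    exact: rc_ge0.
  by rewrite mulr_ge0 ?absK_ge0 ?rc_ge0.
rewrite seminorm_monomial /seminorm -vmaxZ ?(ltW c0)//.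
by apply: eq_vmax => i; rewrite /= h -mulrA.
Qed.

(** On weights, [nuact] permutes by [w] and divides by |d_j|; the two normalizations to maximum 1
    account for the factor in [scales]. *)
Lemma nuact_scales x d w : (forall i, d i != 0) ->
  scales (rc x) (rc (nuact v d w x)) (monomial d w).
Proof.
move=> d0; apply/scales_monomial.
set y := nuact v d w x; pose I' := ((fun i => w i) @: aI x)%SET.
pose z j := if j \in I' then az x ((w^-1)%g j) - (v (d j))%:~R else 0 : R.
have I'0 : I' != finset.set0.
  by have /set0Pn[i ix] := aI_neq0 x; apply/set0Pn; exists (w i); apply: imset_f.
(* The image of a nonempty index set is nonempty, so [insubd] does not return its default value. *)
have yE : sval y = (I', nrm I' z).
  by rewrite /y /nuact /mkAbar; apply: (@insubdK _ _ (Abar R n)); exact: normb_nrm.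
have yI : aI y = I' by rewrite /aI yE.
have yz : az y = nrm (aI y) z by rewrite yI /az yE.
have V0 : 0 < vmax (wt (aI y) z) by apply: vmax_wt_gt0; exact: aI_neq0.
have W0 : 0 < vmax (wt (aI x) (az x)) by apply: vmax_wt_gt0; exact: aI_neq0.
exists (vmax (wt (aI x) (az x)) / vmax (wt (aI y) z)); first exact: divr_gt0.
move=> i; rewrite (rc_nrm _ yz) /rc.
suff -> : wt (aI x) (az x) i = wt (aI y) z (w i) * abs (d (w i)).
  by field; rewrite !gt_eqF.
rewrite /wt yI (mem_imset _ _ (@perm_inj _ w)); case: ifP => [ix|]; last by rewrite mul0r.
rewrite /absK (negbTE (d0 _)) -expRD /z imset_f// permK; congr expR; ring.
Qed.

Lemma nu_relE C x y : nu_rel v C x y <-> N_mat C /\ scales (rc x) (rc y) C.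
Proof.
split=> [[d [w [d0 -> ->]]]|[[d [w [d0 CE]]] h]].
  by split; [exists d, w|exact: nuact_scales].
exists d, w; split => //; apply: scales1_eq.
have h2 := @nuact_scales x d w d0; rewrite CE in h.
by have := scalesM (scalesV (monomial_unit w d0) h2) h; rewrite mulmxV// monomial_unit.
Qed.

(** An element of N that fixes [x] normalizes U_x: conjugation sends the root (i, j) to (w^-1 i,
    w^-1 j), and the factor [c] of the seminorm appears on both sides of the bound and cancels. *)
Lemma gen_elementary_conj x C M : N_mat C -> scales (rc x) (rc x) C ->
  gen_grp (elementary v (rc x)) M ->
  gen_grp (elementary v (rc x)) (invmx C *m M *m C).
Proof.
move=> NC hC; have uC := N_mat_unit NC.
have conjM A B : invmx C *m (A *m B) *m C = (invmx C *m A *m C) *m (invmx C *m B *m C).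
  by rewrite !mulmxA mulmxK.
have elem A : elementary v (rc x) A -> elementary v (rc x) (invmx C *m A *m C).
  case: NC hC => [d [w [d0 ->]]]; rewrite -/(monomial d w) => /scales_monomial[c c0 hc].
  move=> [i [j [u [ij h ->]]]].
  pose i' := (w^-1)%g i; pose j' := (w^-1)%g j; pose u' := u * d j / d i.
  have hi : rc x i * abs (d i) = c * rc x i' by rewrite -hc permKV.
  have hj : rc x j * abs (d j) = c * rc x j' by rewrite -hc permKV.
  exists i', j', u'; split; first by rewrite (inj_eq perm_inj).
    rewrite -(ler_pM2l c0) -hj mulrA -hi /u' !absKM// absKV//.
    have di0 : 0 < abs (d i) by rewrite absK_gt0.
    have -> : rc x i * abs (d i) * (abs u * abs (d j) / abs (d i)) =
        rc x i * abs u * abs (d j) by field; rewrite gt_eqF.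
    by apply: ler_wpM2r => //; exact: absK_ge0.
  have um := monomial_unit w d0.
  apply: (can_inj (mulKmx um)); rewrite -mulmxA mulKVmx//.
  rewrite mulmxDl mulmxDr mul1mx mulmx1; congr (_ + _).
  apply/matrixP => a b; rewrite -scalemxAl -scalemxAr !mxE.
  rewrite (bigD1 j)//= big1 ?addr0 => [|k kj]; last by rewrite mxE (negbTE kj) andbF mul0r.
  rewrite [in RHS](bigD1 i')//= big1 ?addr0 => [|k ki]; last by rewrite !mxE (negbTE ki) mulr0.
  rewrite -!/(monomial _ _) !monomialE !mxE !eqxx andbT /= permKV.
  have -> : (j == w b) = (b == j') by rewrite -(inj_eq (@perm_inj _ w) b) permKV eq_sym.
  have [->|_] := eqVneq a i; last by rewrite !mul0r !mulr0.
  case: eqVneq => _; last by rewrite !mulr0.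
  by rewrite !mulr1 mul1r /u'; field; apply: d0.
elim=> [|A B hA _ IH|A B hA uA _ IH].
- by rewrite mulmx1 mulVmx//; exact: Defs.gen1.
- by rewrite conjM; apply: Defs.genM => //; exact: elem.
- rewrite conjM; have uA' : invmx C *m A *m C \in unitmx by rewrite !unitmx_mul unitmx_inv uA uC.
  suff -> : invmx C *m invmx A *m C = invmx (invmx C *m A *m C).
    by apply: Defs.genV => //; exact: elem.
  apply: (can_inj (mulKmx uA')); rewrite mulmxV//.
  by rewrite -conjM mulmxV// mulmx1 mulVmx.
Qed.

(** If M = A C B stabilizes the class, with A and B in U_x, then so does C. Moving A across C, which
    normalizes U_x, gives the form N_x U_x. *)
Lemma P_matE x M : P_mat v x M <-> M \in unitmx /\ scales (rc x) (rc x) M.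
Proof.
have r0 := rc_ge0 x.
split=> [[A [B [NA /nu_relE[_ hA] [c [B' [c0 gB ->]]] ->]]]|[uM hM]].
  rewrite (Uij_genE v n_gt0) in gB; have [uB iB] := gen_elementary_preserves r0 gB.
  split; first by rewrite unitmx_mul N_mat_unit// unitmxZ// unitfE.
  by apply: scalesM hA; apply: scalesZ => //; exact: preserves_scales.
have [A [C [B [gA NC gB ME]]]] := bruhat_decomposition Kloc r0 r0 uM.
have [uA iA] := gen_elementary_preserves r0 gA; have [uB iB] := gen_elementary_preserves r0 gB.
have uC := N_mat_unit NC.
have hC : scales (rc x) (rc x) C.
  have -> : C = invmx A *m M *m invmx B by rewrite ME !mulmxA mulVmx// mul1mx mulmxK.
  apply: scalesM; first exact/preserves_scales/preservesV.
  by apply: scalesM hM _; exact/preserves_scales/preservesV.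
exists C, (invmx C *m A *m C *m B); split => //; first by apply/nu_relE.
  exists 1, (invmx C *m A *m C *m B); split; rewrite ?scale1r ?oner_neq0//.
  rewrite (Uij_genE v n_gt0); apply: gen_grp_mul => //; exact: gen_elementary_conj.
by rewrite ME !mulmxA mulmxV// mul1mx.
Qed.

End Seminorms.

(** * The equivalence relation on G x Abar, and U_0^ as K^* GL_n(O) *)

Section Classes.
Variables (K : fieldType) (v : K -> int) (R : realType) (n : nat).
Hypothesis Kloc : nonarch_local_field v.
Hypothesis n_gt0 : (0 < n)%N.
Local Notation abs := (absK v R).
Local Notation mx A := (proj1_sig A).
Local Notation cls A := (qproj (@scal_rel K n) A).
Implicit Types (A B : GLt K n) (x y : Abar R n) (X : 'M[K]_n).

Lemma GLt_unit A : mx A \in unitmx. Proof. exact: (proj2_sig A). Qed.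

Lemma scal_rel_refl A : scal_rel A A.
Proof. by exists 1; rewrite oner_neq0 scale1r. Qed.

Lemma scal_rel_sym A B : scal_rel A B -> scal_rel B A.
Proof.
by move=> [c [c0 e]]; exists c^-1; rewrite invr_eq0 e scalerA mulVf// scale1r.
Qed.

Lemma scal_rel_trans A B C : scal_rel A B -> scal_rel B C -> @scal_rel K n A C.
Proof.
move=> [c [c0 e]] [d [d0 f]]; exists (d * c); rewrite mulf_neq0//; split => //.
by rewrite f e scalerA.
Qed.

Lemma cls_eq A B : cls A = cls B <-> exists2 c, c != 0 & mx B = c *: mx A.
Proof.
split=> [/(qproj_inj (scal_rel_refl B)) [c [c0 e]]|[c c0 e]]; first by exists c.
by apply: eq_qproj; [exact: scal_rel_sym|exact: scal_rel_trans|exists c].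
Qed.

Lemma invmxZ_unit (c : K) X : c != 0 -> X \in unitmx ->
  invmx (c *: X) = c^-1 *: invmx X.
Proof.
move=> c0 uX; have uc : c *: X \in unitmx by rewrite unitmxZ// unitfE.
apply: (can_inj (mulKmx uc)); rewrite mulmxV// -scalemxAl -scalemxAr mulmxV//.
by rewrite scalerA mulfV// scale1r.
Qed.

(** In one direction, C (A^-1 B C)^-1 = B^-1 A. In the other, write B^-1 A = P C Q with P in U_y and
    Q in U_x: these preserve their seminorms, so C takes [x] to [y] and is the required element of
    N. *)
Lemma simGE A B x y : simG v (cls A, x) (cls B, y) <->
  scales v (rc x) (rc y) (invmx (mx B) *m mx A).
Proof.
have uA := GLt_unit A; have uB := GLt_unit B.
split=> [[A' [B' [C [/= eA eB NC /(nu_relE Kloc)[_ hC] /(P_matE Kloc n_gt0)[uP hP]]]]]|h].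
  have [a a0 aE] := (cls_eq A' A).1 eA; have [b b0 bE] := (cls_eq B' B).1 eB.
  have uA' := GLt_unit A'; have uB' := GLt_unit B'; have uC := N_mat_unit NC.
  have := scalesM (scalesV uP hP) hC.
  have -> : C *m invmx (invmx (mx A') *m mx B' *m C) = invmx (mx B') *m mx A'.
    apply: (can_inj (mulmxK uP)); rewrite mulmxKV// !mulmxA.
    by rewrite -[_ *m mx A' *m _]mulmxA mulmxV// mulmx1 mulVmx// mul1mx.
  move=> h; rewrite aE bE invmxZ_unit//.
  rewrite -scalemxAl -scalemxAr scalerA.
  by apply: scalesZ => //; rewrite mulf_neq0// invr_eq0.
set M := invmx (mx B) *m mx A in h.
have uM : M \in unitmx by rewrite unitmx_mul unitmx_inv uB uA.
have [P [C [Q [gP NC gQ ME]]]] := bruhat_decomposition Kloc (rc_ge0 y) (rc_ge0 x) uM.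
have [uP iP] := gen_elementary_preserves Kloc (rc_ge0 y) gP.
have [uQ iQ] := gen_elementary_preserves Kloc (rc_ge0 x) gQ.
have uC := N_mat_unit NC.
have hC : scales v (rc x) (rc y) C.
  have -> : C = invmx P *m M *m invmx Q by rewrite ME !mulmxA mulVmx// mul1mx mulmxK.
  apply: scalesM; first exact/preserves_scales/preservesV.
  by apply: scalesM h _; exact/preserves_scales/preservesV.
exists A, B, C; split => //=; first by apply/(nu_relE Kloc).
apply/(P_matE Kloc n_gt0); split; first by rewrite !unitmx_mul unitmx_inv uA uB.
apply: scalesM hC _.
have -> : invmx (mx A) *m mx B = invmx M.
  apply: (can_inj (mulmxK uM)); rewrite mulVmx// /M !mulmxA.
  by rewrite -[_ *m mx B *m _]mulmxA mulmxV// mulmx1 mulVmx.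
exact: scalesV.
Qed.

Definition weight1 (i : 'I_n) : R := 1.
Lemma weight1_ge0 i : 0 <= weight1 i. Proof. exact: ler01. Qed.

(* GL_n(O), as the group of isometries of the maximum norm. *)
Definition GLO X := X \in unitmx /\ preserves v weight1 X.

Lemma GLO_entry X i j : GLO X -> abs (X i j) <= 1.
Proof.
move=> [_ h]; have := seminorm_ub v weight1 (X *m delta_mx j 0) i.
rewrite h (seminorm_delta Kloc _ weight1_ge0).
by rewrite -colE mxE /weight1 mul1r.
Qed.

Lemma GLO_diag X j : GLO X -> (forall i, i != j -> X i j = 0) -> abs (X j j) = 1.
Proof.
move=> [_ h] Xj; have := h (delta_mx j 0); rewrite (seminorm_delta Kloc _ weight1_ge0).
have -> : X *m delta_mx j 0 = X j j *: delta_mx j 0 :> 'cV_n.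
  apply/matrixP => i k; rewrite -colE !mxE ord1 eqxx andbT.
  by have [->|ij] := eqVneq i j; rewrite ?mulr1 ?mulr0 // Xj.
by rewrite seminormZ// (seminorm_delta Kloc _ weight1_ge0) mulr1.
Qed.

Lemma GLO_mulV (A : 'M[K]_n) X : gen_grp (elementary v weight1) A -> GLO (A *m X) -> GLO X.
Proof.
move=> /(gen_elementary_preserves Kloc weight1_ge0)[uA iA] [uX iX].
have e : X = invmx A *m (A *m X) by rewrite mulKmx.
split; first by move: uX; rewrite unitmx_mul => /andP[].
by rewrite e; apply: preservesM => //; exact: preservesV.
Qed.

(* Otherwise X would shrink the vector e_i0 - sum_(k in D) (X_k,i0 / X_kk) e_k. *)
Lemma GLO_pivot X (D : {set 'I_n}) i0 : GLO X -> i0 \notin D ->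
  (forall j, j \in D -> forall i, i != j -> X i j = 0) ->
  exists2 i1, i1 \notin D & abs (X i1 i0) = 1.
Proof.
move=> GX i0D hD.
have Xk k : k \in D -> X k k != 0.
  by move=> kD; rewrite -(absK_gt0 v R) (GLO_diag GX (hD k kD)).
pose a : 'cV[K]_n := \col_k (if k \in D then - (X k i0 / X k k) else (k == i0)%:R).
have Xa i : (X *m a) i 0 = if i \in D then 0 else X i i0.
  rewrite mxE (bigD1 i0)//= mxE (negbTE i0D) eqxx mulr1.
  case: ifP => iD.
    have ii0 : i != i0 by apply: contraTneq iD => ->.
    rewrite (bigD1 i)//= big1 => [|k /andP[ki0 ki]].
      by rewrite mxE iD addr0; field; exact: Xk.
    rewrite mxE; case: ifP => kD; last by rewrite (negbTE ki0) mulr0.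
    by rewrite (hD k kD) ?mul0r// eq_sym.
  rewrite big1 ?addr0// => k ki0; rewrite mxE; case: ifP => kD.
    by rewrite (hD k kD) ?mul0r//; apply: contraTneq kD => <-; rewrite iD.
  by rewrite (negbTE ki0) mulr0.
have a1 : 1 <= seminorm v weight1 (X *m a).
  rewrite GX.2; apply: le_trans (seminorm_ub v weight1 a i0).
  by rewrite mxE (negbTE i0D) eqxx absK1// /weight1 mulr1.
have [i1 e] := vmax_attained (lt_le_trans ltr01 a1).
have : 1 <= weight1 i1 * abs ((X *m a) i1 0) by rewrite -e.
rewrite Xa /weight1 mul1r; case: ifPn => i1D; first by rewrite absK0 ler10.
by move=> h; exists i1 => //; apply/le_anti; rewrite h GLO_entry.
Qed.

Lemma elementary_one i j (u : K) : i != j -> abs u <= 1 ->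
  elementary v weight1 (1%:M + u *: delta_mx i j).
Proof. by move=> ij h; exists i, j, u; split => //; rewrite /weight1 mul1r. Qed.

(** In place of an exchange of rows, a row i1 with an entry of absolute value 1 is added to row i0:
    if the old diagonal entry is smaller than 1, the sum has absolute value exactly 1. Since i1 is
    outside D, the finished columns stay clear. *)
Lemma GLO_unit_pivot X (D : {set 'I_n}) i0 : GLO X -> i0 \notin D ->
  (forall j, j \in D -> forall i, i != j -> X i j = 0) ->
  exists (A : 'M[K]_n) Y, [/\ gen_grp (elementary v weight1) A, X = A *m Y,
    (forall j, j \in D -> forall i, i != j -> Y i j = 0) & abs (Y i0 i0) = 1].
Proof.
move=> GX i0D hD; have [i1 i1D X1] := GLO_pivot GX i0D hD.
have [X0|X0] := eqVneq (abs (X i0 i0)) 1.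
  by exists 1%:M, X; split; [exact: Defs.gen1|rewrite mul1mx| |].
have i01 : i0 != i1 by apply: contra_neq X0 => e; rewrite {1}e.
pose E : 'M[K]_n := 1%:M + 1 *: delta_mx i0 i1.
have E_mul i j : (E *m X) i j = X i j + (if i == i0 then X i1 j else 0).
  rewrite mulmxDl mul1mx mxE scale1r; congr (_ + _).
  rewrite mxE (bigD1 i1)//= big1 => [|k ki]; last by rewrite mxE (negbTE ki) andbF mul0r.
  by rewrite mxE eqxx andbT addr0; case: ifP; rewrite ?mul1r ?mul0r.
exists (1%:M + (- 1) *: delta_mx i0 i1), (E *m X); split.
- by apply/gen_grp1/elementary_one; rewrite // absKN// absK1.
- by rewrite mulmxA mul_elementary// addNr scale0r addr0 mul1mx.
- move=> j jD i ij; rewrite E_mul hD// add0r; case: ifP => // _.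
  by apply: hD => //; apply: contraNneq i1D => ->.
have X0' : abs (X i0 i0) < 1 by rewrite lt_neqAle X0 GLO_entry.
rewrite E_mul eqxx; apply/le_anti/andP; split.
  by apply: absKD => //; exact: GLO_entry.
rewrite leNgt; apply/negP => lt.
pose c := Num.max (abs (X i0 i0)) (abs (X i0 i0 + X i1 i0)).
have : abs (X i1 i0) <= c.
  rewrite -[X i1 i0](addKr (X i0 i0)) addrC.
  by apply: absKB => //; rewrite le_max lexx ?orbT.
by rewrite X1 leNgt /c gt_max X0' lt.
Qed.

(** Row operations with integral coefficients clear one column after another, and an isometry whose
    column vanishes off the diagonal has a unit on it. The diagonal factor will be the part in Z. *)
Lemma GLO_decomposition X : GLO X -> exists (A : 'M[K]_n) d,
  [/\ gen_grp (elementary v weight1) A, forall i, abs (d i) = 1 & X = A *m diagK d].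
Proof.
suff H m (D : {set 'I_n}) Y : #|~: D| = m -> GLO Y ->
    (forall j, j \in D -> forall i, i != j -> Y i j = 0) -> exists (A : 'M[K]_n) d,
    [/\ gen_grp (elementary v weight1) A, forall i, abs (d i) = 1 & Y = A *m diagK d].
  by move=> GX; apply: (H _ finset.set0) => // j; rewrite inE.
elim: m D Y => [|m IH] D Y.
  move/eqP; rewrite cards_eq0 => /eqP DT GY hD.
  have {}hD j i : i != j -> Y i j = 0.
    apply: hD; have : j \notin ~: D by rewrite DT inE.
    by rewrite inE negbK.
  exists 1%:M, (fun i => Y i i); split; first exact: Defs.gen1.
    by move=> i; apply: GLO_diag => // k; exact: hD.
  rewrite mul1mx; apply/matrixP => i j; rewrite mxE.
  by have [->|ij] := eqVneq i j; rewrite // hD.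
move=> Dm GY hD.
have /card_gt0P[i0] : (0 < #|~: D|)%N by rewrite Dm.
rewrite inE => i0D.
have [A [Z [gA YE hZ Z1]]] := GLO_unit_pivot GY i0D hD.
have GZ : GLO Z by apply: (GLO_mulV gA); rewrite -YE.
have Z0 : Z i0 i0 != 0 by rewrite -(absK_gt0 v R) Z1.
pose l i := Z i i0 / Z i0 i0.
have l1 i : abs (l i) <= 1 by rewrite absKM// absKV// Z1 invr1 mulr1 GLO_entry.
pose L := 1%:M + col_transvection i0 l.
pose W := (1%:M + col_transvection i0 (fun i => - l i)) *m Z.
have WE : Z = L *m W.
  apply/matrixP => i j; rewrite !mul_col_transvection eqxx /= addr0.
  by case: ifP => _; rewrite ?addr0// mulNr subrK.
have gL : gen_grp (elementary v weight1) L.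
  by apply: gen_col_transvection => i _; rewrite /weight1 mul1r.
have [||| B [d [gB d1 WB]]] := IH (i0 |: D) W.
- have -> : ~: (i0 |: D) = ~: D :\ i0 by apply/setP => k; rewrite !inE negb_or.
  by have := cardsD1 i0 (~: D); rewrite Dm inE i0D add1n => -[].
- by apply: (GLO_mulV gL); rewrite -WE.
- move=> j; rewrite !inE => jD i ij; rewrite mul_col_transvection.
  have [ji|ji] := eqVneq j i0.
    by rewrite -ji ij /l -ji mulNr divfK ?subrr// ji.
  have {}jD : j \in D by move: jD; rewrite (negbTE ji).
  rewrite hZ//; case: ifP => _; rewrite ?addr0// add0r hZ ?mulr0//.
  by rewrite eq_sym.
exists (A *m (L *m B)), d; split => //; first by do 2?apply: gen_grp_mul.
by rewrite YE WE WB !mulmxA.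
Qed.

Lemma rc_origin_one x : is_origin x -> rc x = weight1.
Proof. by move=> x0; apply/funext => i; exact: rc_origin. Qed.

(** Fixing the origin already makes all |d_i| equal, so an element of Z is a scalar times a diagonal
    matrix of units. Conversely, diagonal units leave all weights unchanged. *)
Lemma Uhat_matE X : @Uhat_mat K v R n X <->
  exists c Y, [/\ c != 0, GLO Y & X = c *: Y].
Proof.
split=> [[x0 [A [B [ox0 [c [A' [c0 gA ->]]] [d [d0 -> hd]] ->]]]]|[c [Y [c0 GY ->]]]].
  rewrite (Uij_genE v n_gt0) (rc_origin_one ox0) in gA.
  have [uA iA] := gen_elementary_preserves Kloc weight1_ge0 gA.
  have := @nuact_scales _ v _ _ Kloc x0 d 1%g d0.
  rewrite hd; last by case: ox0.
  rewrite (rc_origin_one ox0) -diagK_monomial => -[e e0 he].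
  pose k := d (Ordinal n_gt0).
  have ek : abs k = e.
    have := he (delta_mx (Ordinal n_gt0) 0); rewrite (seminorm_delta Kloc _ weight1_ge0) /weight1 mulr1 => <-.
    have -> : diagK d *m delta_mx (Ordinal n_gt0) 0 = k *: delta_mx (Ordinal n_gt0) 0 :> 'cV_n.
      apply/matrixP => i j; rewrite -colE !mxE ord1 eqxx andbT.
      by case: eqVneq => [->|_]; rewrite ?mulr1 ?mulr0.
    by rewrite seminormZ// (seminorm_delta Kloc _ weight1_ge0) mulr1.
  have k0 : k != 0 by exact: d0.
  exists (c * k), (A' *m (k^-1 *: diagK d)); split; first exact: mulf_neq0.
    split.
      by rewrite unitmx_mul uA unitmxZ ?unitfE ?invr_eq0// diagK_monomial monomial_unit.
    apply: preservesM => // a; rewrite -scalemxAl seminormZ// he absKV// ek mulKf// gt_eqF//.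
  by rewrite -scalemxAr scalerA mulfK// scalemxAl.
have [x0 ox0] := exists_origin R n_gt0.
have [A [d [gA d1 YE]]] := GLO_decomposition GY.
have d0 i : d i != 0 by rewrite -(absK_gt0 v R) d1.
exists x0, (c *: A), (diagK d); split => //.
- by exists c, A; split => //; rewrite (Uij_genE v n_gt0) (rc_origin_one ox0).
- exists d; split => // p pT.
  have := @nuact_scales _ v _ _ Kloc p d 1%g d0.
  move/(scales_monomial Kloc) => [e _ he]; apply: (@rc_inj _ _ _ _ e) => i.
  by rewrite -he perm1 d1 mulr1.
- by rewrite YE scalemxAl.
Qed.

Lemma Uhat_lift (u : Uhat v R n) : exists2 A, cls A = proj1_sig u & GLO (mx A).
Proof.
case: u => g [M [/= Mg /Uhat_matE[c [Y [c0 GY ME]]]]].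
exists (exist _ Y GY.1) => //=; rewrite -Mg; apply/cls_eq; exists c => //.
Qed.

Lemma GLO_Uhat A : GLO (mx A) -> Uhat_G v R (cls A).
Proof.
by move=> h; exists A; split => //; apply/Uhat_matE; exists 1, (mx A); rewrite oner_neq0 scale1r.
Qed.

End Classes.

(** * Uniform distance between norms on the unit ball *)

Section Distance.
Variables (K : fieldType) (v : K -> int) (R : realType) (n : nat).
Hypothesis Kloc : nonarch_local_field v.
Hypothesis n_gt0 : (0 < n)%N.
Local Notation abs := (absK v R).
Local Notation mx A := (proj1_sig A).
Local Notation cls A := (qproj (@scal_rel K n) A).
Local Notation weight1 := (@weight1 R n).
Local Notation snorm := (seminorm v weight1).
Implicit Types (A B : GLt K n) (x y : Abar R n) (M k : 'M[K]_n) (a b : 'cV[K]_n).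

Lemma seminorm_dist (r : 'I_n -> R) a b : (forall i, 0 <= r i) ->
  `|seminorm v r a - seminorm v r b| <= seminorm v r (a - b).
Proof.
move=> r0; have h c d : seminorm v r c <= seminorm v r (c - d) + seminorm v r d.
  rewrite -{1}[c](subrK d); apply: seminormD => //.
    by rewrite lerDl seminorm_ge0.
  by rewrite lerDr seminorm_ge0.
rewrite ler_norml; apply/andP; split; last by have := h a b; lra.
by have := h b a; rewrite -[b - a]opprB seminormN//; lra.
Qed.

Lemma seminorm_le_snorm (r : 'I_n -> R) a : (forall i, r i <= 1) -> seminorm v r a <= snorm a.
Proof.
move=> r1; apply: vmax_le => [|i]; first exact: seminorm_ge0.
by apply: le_trans (seminorm_ub v weight1 a i); apply: ler_wpM2r => //; exact: absK_ge0.
Qed.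

Lemma seminorm_weights (r s : 'I_n -> R) a (e : R) : 0 <= e -> (forall i, `|r i - s i| <= e) ->
  `|seminorm v r a - seminorm v s a| <= e * snorm a.
Proof.
move=> e0 h; apply: vmax_dist => [|i]; first by rewrite mulr_ge0 ?seminorm_ge0.
rewrite -mulrBl normrM (ger0_norm (absK_ge0 _ _ _)); apply: ler_pM => //.
  exact: absK_ge0.
by have := seminorm_ub v weight1 a i; rewrite /weight1 mul1r.
Qed.

Lemma snorm_entry a i : abs (a i 0) <= snorm a.
Proof. by have := seminorm_ub v weight1 a i; rewrite /weight1 mul1r. Qed.

Lemma snorm_le a (e : R) : 0 <= e -> (forall i, abs (a i 0) <= e) -> snorm a <= e.
Proof. by move=> e0 h; apply: vmax_le => // i; rewrite /weight1 mul1r. Qed.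

Lemma snorm_eq0 a : snorm a <= 0 -> a = 0.
Proof.
move=> h; apply/matrixP => i j; rewrite ord1 mxE; apply/eqP.
rewrite -(absK_eq0 v R); apply/eqP/le_anti; rewrite absK_ge0 andbT.
by apply: le_trans h; exact: snorm_entry.
Qed.

Lemma snormD a b (e : R) : snorm a <= e -> snorm b <= e -> snorm (a + b) <= e.
Proof. by apply: seminormD => //; exact: weight1_ge0. Qed.

Lemma snorm_mulmx M a (e : R) : 0 <= e -> (forall i j, abs (M i j) <= e) ->
  snorm (M *m a) <= e * snorm a.
Proof.
move=> e0 h; apply: snorm_le => [|i]; first by rewrite mulr_ge0 ?seminorm_ge0.
rewrite mxE; apply: absK_sum => // [|j _]; first by rewrite mulr_ge0 ?seminorm_ge0.
by rewrite absKM// ler_pM ?absK_ge0// snorm_entry.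
Qed.

(** The operator norm of k - 1 is at most [e]. For 0 <= e < 1 these matrices form a subgroup of
    GL_n(O), which is why neighbourhoods in G are written multiplicatively. *)
Definition close1 (e : R) k := forall a, snorm (k *m a - a) <= e * snorm a.

Lemma close1_entries (e : R) k : 0 <= e -> (forall i j, abs ((k - 1%:M) i j) <= e) -> close1 e k.
Proof. by move=> e0 h a; rewrite -{2}[a]mul1mx -mulmxBl; exact: snorm_mulmx. Qed.

Lemma close1_preserves (e : R) k : e < 1 -> close1 e k -> preserves v weight1 k.
Proof.
move=> e1 hk a; have h := hk a.
have [a0|a0] := lerP (snorm a) 0; first by rewrite (snorm_eq0 a0) mulmx0.
have lt : snorm (k *m a - a) < snorm a by apply: le_lt_trans h _; rewrite gtr_pMl.
apply/le_anti/andP; split.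
  rewrite -[k *m a](subrK a); apply: snormD => //.
  exact: ltW.
rewrite leNgt; apply/negP => lt2.
suff : snorm a <= Num.max (snorm (k *m a)) (snorm (k *m a - a)).
  by rewrite leNgt gt_max lt lt2.
have {1}-> : a = k *m a + - (k *m a - a) by rewrite opprB addrC subrK.
by apply: snormD; [rewrite le_max lexx|rewrite seminormN// le_max lexx orbT].
Qed.

Lemma preserves_unit k : preserves v weight1 k -> k \in unitmx.
Proof.
move=> hk; rewrite -unitmx_tr -row_free_unit; apply: inj_row_free => w wk.
apply: trmx_inj; rewrite trmx0; apply: snorm_eq0.
rewrite -hk -[k *m _]trmxK trmx_mul trmxK wk trmx0 (seminorm0 v) //.
Qed.

Lemma close1_unit (e : R) k : e < 1 -> close1 e k -> k \in unitmx.
Proof. by move=> e1 /(close1_preserves e1) /preserves_unit. Qed.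

Lemma close1_GLO (e : R) k : e < 1 -> close1 e k -> GLO v R k.
Proof. by move=> e1 hk; split; [exact: close1_unit hk|exact: close1_preserves hk]. Qed.

Lemma close1M (e : R) k k' : e < 1 -> close1 e k -> close1 e k' -> close1 e (k *m k').
Proof.
move=> e1 hk hk' a; rewrite -mulmxA -(subrK (k' *m a) (k *m _)) -addrA.
apply: snormD => //.
by apply: le_trans (hk _) _; rewrite (close1_preserves e1 hk').
Qed.

Lemma close1V (e : R) k : e < 1 -> close1 e k -> close1 e (invmx k).
Proof.
move=> e1 hk a; have uk := close1_unit e1 hk; have ik := preservesV uk (close1_preserves e1 hk).
rewrite -[a in _ - a](mulKmx uk) -mulmxBr ik -opprB seminormN// -[leRHS]mulr1 mulr1.
Qed.

Lemma GLOM M M' : GLO v R M -> GLO v R M' -> GLO v R (M *m M').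
Proof.
by move=> [uM iM] [uM' iM']; split; [rewrite unitmx_mul uM uM'|exact: preservesM].
Qed.

Lemma GLOV M : GLO v R M -> GLO v R (invmx M).
Proof. by move=> [uM iM]; split; [rewrite unitmx_inv|exact: preservesV]. Qed.

Lemma close1_quotient (e : R) M M' : 0 <= e -> GLO v R M ->
  (forall i j, abs (M' i j - M i j) <= e) -> close1 e (M' *m invmx M).
Proof.
move=> e0 GM h; apply: close1_entries => // i j.
rewrite -(mulmxV GM.1) -mulmxBl mxE; apply: absK_sum => // l _.
rewrite absKM// -[leRHS]mulr1; apply: ler_pM; rewrite ?absK_ge0// ?mxE//.
exact: (GLO_entry Kloc _ _ (GLOV GM)).
Qed.

Lemma matrix_bound M : exists2 c : R, 0 < c & forall i j, abs (M i j) <= c.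
Proof.
exists (1 + vmax (fun i => vmax (fun j => abs (M i j)))).
  by rewrite ltr_pwDl// vmax_ge0.
move=> i j; apply: le_trans (vmax_ub (fun j => abs (M i j)) j) _.
apply: le_trans (vmax_ub (fun i => vmax (fun j => abs (M i j))) i) _.
by rewrite lerDr.
Qed.

Definition PGL_ball (e : R) A : PGL K n -> Prop :=
  fun g => exists B k c, [/\ cls B = g, c != 0, close1 e k & mx B = c *: (k *m mx A)].

Lemma PGL_ball_center (e : R) A : 0 <= e -> PGL_ball e A (cls A).
Proof.
move=> e0; exists A, 1%:M, 1; split; rewrite ?oner_neq0 ?scale1r ?mul1mx//.
by move=> a; rewrite mul1mx subrr (seminorm0 v)// mulr_ge0 ?seminorm_ge0.
Qed.

Lemma PGL_ball_open (e : R) A : 0 < e -> e < 1 -> PGL_open v (PGL_ball e A).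
Proof.
move=> e0 e1.
exists (fun M => exists k c, [/\ c != 0, close1 e k & M = c *: (k *m mx A)]); split; last first.
  move=> B; split=> [[B' [k [c [/cls_eq[d d0 BE] c0 hk BE']]]]|[k [c [c0 hk BE]]]].
    exists k, (d * c); split => //; first by rewrite mulf_neq0.
    by rewrite BE BE' scalerA.
  by exists B, k, c.
move=> M [k [c [c0 hk ME]]].
have uM : M \in unitmx.
  by rewrite ME unitmxZ ?unitfE// unitmx_mul (close1_unit e1 hk) GLt_unit.
(* M' M^-1 - 1 = (M' - M) M^-1, so precision e / d suffices when [d] bounds the entries of M^-1. *)
have [d d0 hd] := matrix_bound (invmx M).
have [m _ hm] := eps_small (divr_gt0 e0 d0).
exists m%:Z => M' hM'; exists (M' *m invmx M *m k), c; split => //.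
  apply: close1M => //; apply: close1_entries; first exact: ltW.
  move=> i j; rewrite -(mulmxV uM) -mulmxBl mxE; apply: absK_sum => //; first exact: ltW.
  move=> l _; rewrite absKM//; apply: (@le_trans _ _ (e / d * d)); last by rewrite divfK ?gt_eqF.
  apply: ler_pM; rewrite ?absK_ge0//; apply: le_trans hm.
  by rewrite !mxE; apply/closeP; exact: hM'.
by rewrite -!mulmxA scalemxAr scalemxAr -ME mulVmx// mulmx1.
Qed.

Definition pnorm M x a := seminorm v (rc x) (invmx M *m a).

Definition near_on_ball (d : R) (f g : 'cV[K]_n -> R) := forall a, snorm a <= 1 -> `|f a - g a| <= d.

Lemma near_sym d f g : near_on_ball d f g -> near_on_ball d g f.
Proof. by move=> h a a1; rewrite distrC h. Qed.

Lemma near_trans d e f g h : near_on_ball d f g -> near_on_ball e g h -> near_on_ball (d + e) f h.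
Proof.
move=> h1 h2 a a1; rewrite -[f a](subrK (g a)) -addrA.
by apply: le_trans (ler_normD _ _) _; rewrite lerD ?h1 ?h2.
Qed.

Lemma pnorm_le1 M x a : GLO v R M -> snorm a <= 1 -> pnorm M x a <= 1.
Proof.
move=> GM a1; apply: le_trans (seminorm_le_snorm _ (rc_le1 x)) _.
by rewrite (GLOV GM).2.
Qed.

Lemma pnorm_max M x : GLO v R M -> exists2 a, snorm a <= 1 & pnorm M x a = 1.
Proof.
move=> GM; have [i xi] := rc_max x; exists (M *m delta_mx i 0).
  by rewrite GM.2 (seminorm_delta Kloc _ (@weight1_ge0 R n)).
by rewrite /pnorm mulKmx ?GM.1// (seminorm_delta Kloc _ (rc_ge0 x)).
Qed.

Lemma pnormZ M x (c : K) a : pnorm M x (c *: a) = abs c * pnorm M x a.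
Proof. by rewrite /pnorm -scalemxAr seminormZ. Qed.

Lemma pnorm_dist M x a b : GLO v R M -> `|pnorm M x a - pnorm M x b| <= snorm (a - b).
Proof.
move=> GM; apply: le_trans (seminorm_dist _ _ (rc_ge0 x)) _.
by rewrite -mulmxBr; apply: le_trans (seminorm_le_snorm _ (rc_le1 x)) _; rewrite (GLOV GM).2.
Qed.

Lemma near_pnorm_close1 (e : R) k M x : e < 1 -> close1 e k -> GLO v R M ->
  near_on_ball e (pnorm (k *m M) x) (pnorm M x).
Proof.
move=> e1 hk GM a a1; have uk := close1_unit e1 hk.
have e0 : 0 <= e.
  have := hk (delta_mx (Ordinal n_gt0) 0).
  rewrite (seminorm_delta Kloc _ (@weight1_ge0 R n)) /weight1 mulr1.
  by apply: le_trans; exact: seminorm_ge0.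
have -> : pnorm (k *m M) x a = pnorm M x (invmx k *m a).
  rewrite /pnorm mulmxA; congr (seminorm _ _ (_ *m _)).
  have ukM : k *m M \in unitmx by rewrite unitmx_mul uk GM.1.
  apply: (can_inj (mulmxK ukM)); rewrite mulVmx// mulmxA.
  by rewrite -[_ *m k]mulmxA mulVmx// mulmx1 mulVmx// GM.1.
apply: le_trans (pnorm_dist _ _ _ GM) _.
by apply: le_trans (close1V e1 hk a) _; rewrite ler_piMr.
Qed.

Lemma near_pnorm_rc (e : R) M x y : 0 <= e -> GLO v R M ->
  (forall i, `|rc x i - rc y i| <= e) -> near_on_ball e (pnorm M x) (pnorm M y).
Proof.
move=> e0 GM h a a1; apply: le_trans (seminorm_weights _ e0 h) _.
by rewrite (GLOV GM).2 ler_piMr.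
Qed.

Lemma absKX (p : K) (m : nat) : abs p = eps R 1 -> abs (p ^+ m) = eps R m%:Z.
Proof.
move=> pE; elim: m => [|m IH]; first by rewrite expr0 absK1// /eps oppr0 expR0.
by rewrite exprS absKM// IH pE /eps -expRD -opprD -intrD.
Qed.

Lemma small_scalar (s : R) : 0 <= s -> exists2 c : K, c != 0 & abs c * s <= 1.
Proof.
move=> s0; have [p [p0 pE]] := uniformizer R Kloc.
have s1 : 0 < s + 1 by rewrite ltr_pwDr.
have s1' : 0 < (s + 1)^-1 by rewrite invr_gt0.
have [m _ hm] := eps_small s1'.
exists (p ^+ m); first by rewrite expf_neq0.
rewrite absKX//; apply: (@le_trans _ _ ((s + 1)^-1 * (s + 1))).
  by apply: ler_pM hm _; rewrite ?(ltW (eps_gt0 _ _))// lerDl.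
by rewrite mulVf// gt_eqF.
Qed.

(** Both sides are homogeneous, and every vector has a nonzero multiple in the unit ball. *)
Lemma near_eq M M' x y : (forall e : R, 0 < e -> near_on_ball e (pnorm M x) (pnorm M' y)) ->
  forall a, pnorm M x a = pnorm M' y a.
Proof.
move=> h a; have [c c0] := small_scalar (seminorm_ge0 v weight1 a).
rewrite -seminormZ// => ca.
have ac : 0 < abs c by rewrite absK_gt0.
apply: (@mulfI _ (abs c)); first by rewrite gt_eqF.
rewrite -!pnormZ; apply/eqP; rewrite -subr_eq0 -normr_eq0; apply: contraT => ne.
have {}ne : 0 < `|pnorm M x (c *: a) - pnorm M' y (c *: a)| by rewrite lt_def ne normr_ge0.
by have := h _ (divr_gt0 ne (ltr0Sn _ 1)) _ ca; lra.
Qed.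

(** Proportional norms that both have maximum 1 on the unit ball are equal; this replaces homothety
    classes by functions. *)
Lemma scales_pnorm M M' x y : GLO v R M -> GLO v R M' ->
  scales v (rc x) (rc y) (invmx M' *m M) <-> forall a, pnorm M x a = pnorm M' y a.
Proof.
move=> GM GM'; split=> [[c c0 h] a|h]; last first.
  by exists 1 => // a; rewrite mul1r -mulmxA -[LHS]h /pnorm mulKmx// GM.1.
have {}h b : pnorm M' y b = c * pnorm M x b by rewrite -h -mulmxA mulKVmx// GM.1.
suff c1 : c = 1 by rewrite h c1 mul1r.
apply/le_anti/andP; split.
  have [b b1 e] := pnorm_max x GM.
  by have := pnorm_le1 y GM' b1; rewrite h e mulr1.
have [b b1 e] := pnorm_max y GM'.
by rewrite -[leLHS]e h ler_piMr ?(ltW c0)// pnorm_le1.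
Qed.

Lemma simXE (u w : Uhat v R n) A B x y :
  cls A = proj1_sig u -> cls B = proj1_sig w -> GLO v R (mx A) -> GLO v R (mx B) ->
  simX (u, x) (w, y) <-> forall a, pnorm (mx A) x a = pnorm (mx B) y a.
Proof.
by move=> Au Bw GA GB; rewrite /simX /= -Au -Bw simGE//; exact: scales_pnorm.
Qed.

Lemma rc_ball_open x (e : R) : Abar_open (fun y => forall i, `|rc y i - rc x i| < e).
Proof.
apply: rc_open_Abar_open => // y hy; have [d d0 hd] := ball_radius hy.
by exists d => // z hz i; exact: hd.
Qed.

(** The intermediate [e] strictly below [d] leaves the margin that makes the set open without a
    supremum over the ball. *)
Definition near_set (d : R) (f : 'cV[K]_n -> R) (p : Uhat v R n * Abar R n) :=
  exists A e, [/\ cls A = proj1_sig p.1, GLO v R (mx A), e < d & near_on_ball e (pnorm (mx A) p.2) f].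

Lemma near_set_open d f : prod_open (@Uhat_open K v R n) (@Abar_open R n) (near_set d f).
Proof.
move=> [u x] [A [e [/= Au GA ed hA]]].
(* Moving the matrix and moving the point cost [t] each, and e + 2 t < d. *)
pose t := Num.min ((d - e) / 3%:R) (1 / 2).
have t0 : 0 < t by rewrite lt_min; apply/andP; split; lra.
have t1 : t < 1 by rewrite gt_min; apply/orP; right; lra.
have td : t <= (d - e) / 3%:R by rewrite ge_min lexx.
exists (fun w => PGL_ball t A (proj1_sig w)), (fun y => forall i, `|rc y i - rc x i| < t); split => /=.
- by exists (PGL_ball t A); split => //; exact: PGL_ball_open.
- exact: rc_ball_open.
- by rewrite -Au; apply: PGL_ball_center; exact: ltW.
- by move=> i; rewrite subrr normr0.
move=> w y [B [k [c [Bw c0 hk BE]]]] hy.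
have GkA : GLO v R (k *m mx A) by apply: GLOM => //; exact: close1_GLO hk.
exists (exist _ (k *m mx A) GkA.1), (t + (t + e)); split => //=.
- by rewrite -Bw; apply/cls_eq; exists c.
- lra.
apply: near_trans (near_pnorm_close1 _ t1 hk GA) _; apply: near_trans hA.
by apply: near_pnorm_rc => // [|i]; [exact: ltW|exact/ltW/hy].
Qed.

End Distance.

(** * Limits along an ultrafilter *)

Section UltraLimits.
Variables (T : Type) (G : set (set T)).
Hypothesis GU : UltraFilter G.

Lemma ultra_pigeonhole (I : eqType) (r : seq I) (P : I -> set T) :
  G (fun t => exists2 i, i \in r & P i t) -> exists2 i, i \in r & G (P i).
Proof.
elim: r => [|i r IH] Gr.
  by have [t [j]] := filter_ex Gr; rewrite in_nil.
have [Gi|Gi] := in_ultra_setVsetC (P i) GU; first by exists i; rewrite ?mem_head.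
have [|j jr Gj] := IH; last by exists j; rewrite // in_cons jr orbT.
apply: filterS (filterI Gr Gi) => t [[j]]; rewrite in_cons => /orP[/eqP ->|jr] Pj //.
by exists j.
Qed.

(** The limit is the supremum of the lower bounds that [f] satisfies on a member of [G]. Slightly
    above it the set where [f] is larger is not in [G], so its complement is. *)
Lemma ultra_real_limit (R : realType) (f : T -> R) : (forall t, 0 <= f t <= 1) ->
  exists l, forall e : R, 0 < e -> G (fun t => `|f t - l| < e).
Proof.
move=> f01; pose E : set R := fun s => G (fun t => s <= f t).
have E0 : E 0 by apply: filterS filterT => t _; case/andP: (f01 t).
have E1 : ubound E 1.
  by move=> s /filter_ex[t]; case/andP: (f01 t) => _ h /le_trans; apply.
have Es : has_sup E by split; [exists 0|exists 1].
exists (sup E) => e e0.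
have [s Es' hs] := sup_adherent e0 Es.
have hn : ~ E (sup E + e / 2).
  by move=> h; have := sup_upper_bound Es h; lra.
have [//|Gn] := in_ultra_setVsetC (fun t => sup E + e / 2 <= f t) GU.
apply: filterS (filterI Es' Gn) => t [h1 /negP]; rewrite -ltNge => h2.
by rewrite ltr_norml; apply/andP; split; lra.
Qed.

End UltraLimits.

(** * Compactness of GL_n(O) x Abar and the topology of [Xbar] *)

Section Compactness.
Variables (K : fieldType) (v : K -> int) (R : realType) (n : nat).
Hypothesis Kloc : nonarch_local_field v.
Hypothesis n_gt0 : (0 < n)%N.
Local Notation abs := (absK v R).
Local Notation mx A := (proj1_sig A).
Local Notation cls A := (qproj (@scal_rel K n) A).

(** Digit expansion: an approximation y to precision m is improved by p^m z, with z among finitely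
    many residues. *)
Lemma residues (m : nat) : exists r : seq K, forall x, abs x <= 1 ->
  exists2 y, y \in r & abs (x - y) <= eps R m%:Z.
Proof.
elim: m => [|m [r hr]].
  exists [:: 0] => x x1; exists 0; first exact: mem_head.
  by rewrite subr0 /eps oppr0 expR0.
case: (Kloc) => _ _ _ _ [q hq].
have [p [p0 pE]] := uniformizer R Kloc.
have ppE : abs (p ^+ m) = eps R m%:Z by exact: absKX.
have pp0 : p ^+ m != 0 by rewrite expf_neq0.
have ap0 : 0 < abs (p ^+ m) by rewrite absK_gt0.
exists [seq y + p ^+ m * z | y <- r, z <- q] => x x1.
have [y yr xy] := hr x x1.
have h0 : Defs.close v 0 ((x - y) / p ^+ m) 0.
  apply/(closeP v R); rewrite subr0 absKM// absKV// /eps oppr0 expR0.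
  by rewrite ler_pdivrMr// mul1r ppE.
have [z zq [_ /(closeP v R) hz]] := hq _ h0.
exists (y + p ^+ m * z); first exact: allpairs_f.
have -> : x - (y + p ^+ m * z) = p ^+ m * ((x - y) / p ^+ m - z) by field.
rewrite absKM// ppE -[m.+1]addn1; have -> : eps R (m + 1)%N%:Z = eps R m%:Z * eps R 1.
  by rewrite /eps -expRD PoszD intrD opprD.
by rewrite ler_pM2l// eps_gt0.
Qed.

Lemma eps_le (m k : nat) : (m <= k)%N -> eps R k%:Z <= eps R m%:Z.
Proof. by move=> mk; rewrite ler_expR lerN2 ler_int lez_nat. Qed.

(** For each m, one of finitely many balls of radius e^(-m) contains [s t] for all t in a member of
    [G]. Two members of [G] meet, so the centres form a Cauchy sequence. *)
Lemma ultra_field_limit (T : Type) (G : set (set T)) (s : T -> K) : UltraFilter G ->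
  (forall t, abs (s t) <= 1) ->
  exists l, forall m : nat, G (fun t => abs (s t - l) <= eps R m%:Z).
Proof.
move=> GU s1.
have {}h (m : nat) : exists y, G (fun t => abs (s t - y) <= eps R m%:Z).
  have [r hr] := residues m.
  have [|y _ Gy] := @ultra_pigeonhole T G GU _ r (fun y t => abs (s t - y) <= eps R m%:Z).
    by apply: filterS filterT => t _; exact: hr.
  by exists y.
have [y hy] := choice h.
case: (Kloc) => _ _ _ complete _.
have [|l hl] := complete y.
  move=> m; exists `|m|%N => i j mi mj; apply/(closeP v R).
  have [t [/= hi hj]] := filter_ex (filterI (hy i) (hy j)).
  have le k : (`|m| <= k)%N -> eps R k%:Z <= eps R m.
    move=> mk; rewrite ler_expR lerN2 ler_int; apply: le_trans (_ : (`|m|%N)%:Z <= _).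
      by rewrite abszE ler_norm.
    by rewrite lez_nat.
  have -> : y i - y j = (s t - y j) - (s t - y i) by ring.
  by apply: absKB => //; [exact: le_trans hj (le _ mj)|exact: le_trans hi (le _ mi)].
exists l => m; have [N hN] := hl m%:Z.
have := hN _ (leq_maxl N m) => /(closeP v R) hm.
apply: filterS (hy (maxn N m)) => t ht.
have -> : s t - l = (s t - y (maxn N m)) + (y (maxn N m) - l) by ring.
by apply: absKD => //; apply: le_trans ht _; apply: eps_le; exact: leq_maxr.
Qed.

Lemma le_eps_eq0 (c : K) : (forall m : nat, abs c <= eps R m%:Z) -> c = 0.
Proof.
move=> h; apply/eqP; rewrite -(absK_eq0 v R); apply: contraT => c0.
have {}c0 : 0 < abs c by rewrite lt_def c0 absK_ge0.
have [m _ hm] := eps_small (divr_gt0 c0 (ltr0Sn R 1)).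
by have := le_trans (h m) hm; lra.
Qed.

Lemma eps_le1 (m : nat) : eps R m%:Z <= 1.
Proof. by rewrite expR_le1 oppr_le0 ler0z. Qed.

Lemma ultra_matrix_limit (T : Type) (G : set (set T)) (X : T -> 'M[K]_n) : UltraFilter G ->
  (forall t i j, abs (X t i j) <= 1) ->
  exists Y : 'M[K]_n, (forall i j, abs (Y i j) <= 1) /\
    forall m : nat, G (fun t => forall i j, abs (X t i j - Y i j) <= eps R m%:Z).
Proof.
move=> GU X1.
have h i : exists l : 'I_n -> K, forall j (m : nat),
    G (fun t => abs (X t i j - l j) <= eps R m%:Z).
  have hj j := ultra_field_limit GU (fun t => X1 t i j).
  by have [l hl] := choice hj; exists l.
have [l hl] := choice h.
exists (\matrix_(i, j) l i j); split=> [i j|m].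
  have [t /= ht] := filter_ex (hl i j 0%N).
  rewrite mxE -[l i j](subKr (X t i j)); apply: absKB => //.
  by apply: le_trans ht _; exact: eps_le1.
apply: filter_forall => i; apply: filter_forall => j.
by apply: filterS (hl i j m) => t; rewrite mxE.
Qed.

Lemma GLO_of_entries (X Y : 'M[K]_n) : X *m Y = 1%:M ->
  (forall i j, abs (X i j) <= 1) -> (forall i j, abs (Y i j) <= 1) -> GLO v R X.
Proof.
move=> XY hX hY; have [uX uY] := mulmx1_unit XY; split => // a.
have le (M : 'M[K]_n) (b : 'cV[K]_n) : (forall i j, abs (M i j) <= 1) -> seminorm v (@weight1 R n) (M *m b) <= seminorm v (@weight1 R n) b.
  by move=> hM; have := snorm_mulmx Kloc b ler01 hM; rewrite mul1r.
apply/le_anti/andP; split; first exact: le.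
have {1}-> : a = Y *m (X *m a) by rewrite mulmxA (mulmx1C XY) mul1mx.
exact: le.
Qed.

(** To keep the limit invertible, the inverses are given a limit along the same ultrafilter; the
    product of the two limits is 1. *)
Lemma ultra_GLO_limit (T : Type) (G : set (set T)) (X : T -> 'M[K]_n) : UltraFilter G ->
  (forall t, GLO v R (X t)) -> exists2 Y, GLO v R Y &
    forall m : nat, G (fun t => forall i j, abs (X t i j - Y i j) <= eps R m%:Z).
Proof.
move=> GU GX.
have [Y [Y1 hY]] := ultra_matrix_limit GU (fun t i j => GLO_entry Kloc i j (GX t)).
have [Z [Z1 hZ]] := ultra_matrix_limit GU (fun t i j => GLO_entry Kloc i j (GLOV (GX t))).
exists Y => //; apply: (@GLO_of_entries _ Z) => //.
apply/eqP; rewrite -subr_eq0; apply/eqP/matrixP => i j; rewrite [RHS]mxE.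
apply: le_eps_eq0 => m.
have [t [/= hX' hZ']] := filter_ex (filterI (hY m) (hZ m)).
have -> : Y *m Z - 1%:M = (Y - X t) *m Z + X t *m (Z - invmx (X t)).
  by rewrite mulmxBl mulmxBr mulmxV ?(GX t).1// addrA subrK.
have e0 := ltW (eps_gt0 R m%:Z).
rewrite mxE; apply: absKD => //; rewrite mxE; apply: absK_sum => // l _; rewrite absKM//.
  rewrite -[leRHS]mulr1; apply: ler_pM; rewrite ?absK_ge0//.
  by rewrite !mxE absK_distC// hX'.
rewrite -[leRHS]mul1r; apply: ler_pM; rewrite ?absK_ge0//; first exact: GLO_entry.
by rewrite !mxE absK_distC// hZ'.
Qed.

(** The limit weights still have maximum 1, because one fixed coordinate equals 1 on a member of
    [G]. *)
Lemma ultra_Abar_limit (T : Type) (G : set (set T)) (x : T -> Abar R n) : UltraFilter G ->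
  exists y, forall e : R, 0 < e -> G (fun t => forall i, `|rc (x t) i - rc y i| < e).
Proof.
move=> GU.
have h i : exists l, forall e : R, 0 < e -> G (fun t => `|rc (x t) i - l| < e).
  by apply: ultra_real_limit => t; rewrite rc_ge0 rc_le1.
have [l hl] := choice h.
have l_ge0 i : 0 <= l i.
  rewrite leNgt; apply/negP => l0; have l0' : 0 < - l i by rewrite oppr_gt0.
  have [t /=] := filter_ex (hl i _ l0'); have := rc_ge0 (x t) i.
  by rewrite ltr_norml => + /andP[_]; lra.
have l_le1 i : l i <= 1.
  rewrite leNgt; apply/negP => l0; have l0' : 0 < l i - 1 by rewrite subr_gt0.
  have [t /=] := filter_ex (hl i _ l0'); have := rc_le1 (x t) i.
  by rewrite ltr_norml => + /andP[+ _]; lra.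
have [|i _ Gi] := @ultra_pigeonhole T G GU _ (enum 'I_n) (fun i t => rc (x t) i = 1).
  by apply: filterS filterT => t _; have [i xi] := rc_max (x t); exists i; rewrite ?mem_enum.
have li : l i = 1.
  apply/le_anti; rewrite l_le1 leNgt; apply/negP => lt.
  have lt' : 0 < 1 - l i by rewrite subr_gt0.
  have [t [/= ->]] := filter_ex (filterI Gi (hl i _ lt')).
  by rewrite gtr0_norm// ltxx.
have [|y hy] := rc_surj l_ge0.
  apply/le_anti/andP; split; first exact: vmax_le.
  by rewrite -[leLHS]li vmax_ub.
exists y => e e0; apply: filter_forall => j.
by apply: filterS (hl j e e0) => t; rewrite hy.
Qed.

(* GL_n(O) x Abar is compact and maps continuously to the seminorms, so the image of a
   saturated open set is open for uniform convergence on O^n. *)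
Lemma saturated_open_near (O : Uhat v R n * Abar R n -> Prop) (u0 : Uhat v R n) x0 A0 :
  prod_open (@Uhat_open K v R n) (@Abar_open R n) O ->
  (forall p q, simX p q -> O p -> O q) -> O (u0, x0) ->
  cls A0 = proj1_sig u0 -> GLO v R (mx A0) ->
  exists2 d : R, 0 < d & forall (u : Uhat v R n) x A, cls A = proj1_sig u -> GLO v R (mx A) ->
    near_on_ball v d (pnorm v (mx A) x) (pnorm v (mx A0) x0) -> O (u, x).
Proof.
move=> Oo Osat O0 A0u GA0; apply: contrapT => hno.
pose bad (k : nat) (s : Uhat v R n * Abar R n * GLt K n) :=
  [/\ cls s.2 = proj1_sig s.1.1, GLO v R (mx s.2), ~ O s.1 &
      near_on_ball v (k.+1%:R^-1) (pnorm v (mx s.2) s.1.2) (pnorm v (mx A0) x0)].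
have hbad k : exists s, bad k s.
  apply: contrapT => hk; apply: hno; exists (k.+1%:R^-1); first by rewrite invr_gt0.
  move=> u x A Au GA h; apply: contrapT => nO; apply: hk; exists (u, x, A).
  by split.
have [s hs] := choice hbad.
(* The counterexamples, the k-th within 1 / (k + 1) of the given norm, receive a limit along an
   ultrafilter finer than the filter at infinity. *)
have [G [GU GN]] := ultraFilterLemma eventually_filter.
have [Y GY hY] := @ultra_GLO_limit nat G (fun k => mx (s k).2) GU (fun k => let: And4 _ g _ _ := hs k in g).
have [y hy] := @ultra_Abar_limit nat G (fun k => (s k).1.2) GU.
pose A : GLt K n := exist _ Y GY.1.
pose u : Uhat v R n := exist _ (cls A) (@GLO_Uhat K v R n Kloc n_gt0 A GY).
have fE a : pnorm v Y y a = pnorm v (mx A0) x0 a.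
  apply: (near_eq Kloc) => e e0.
  pose e3 := Num.min (e / 3%:R) (1 / 2).
  have e30 : 0 < e3 by rewrite lt_min; apply/andP; split; lra.
  have e31 : e3 < 1 by rewrite gt_min; apply/orP; right; lra.
  have e3e : e3 <= e / 3%:R by rewrite ge_min lexx.
  have [m _ hm] := eps_small e30.
  have Gm : G (fun k => (Num.bound e3^-1 <= k)%N) by apply: GN; exists (Num.bound e3^-1).
  have [k [[/= h1 h2] h3]] := filter_ex (filterI (filterI (hY m) (hy _ e30)) Gm).
  have [Au GA _ hk] := hs k.
  have k3 : k.+1%:R^-1 <= e3.
    rewrite -[e3]invrK lef_pV2 ?posrE ?invr_gt0//.
    have e3'0 : 0 <= e3^-1 by rewrite invr_ge0 ltW.
    apply: le_trans (ltW (archi_boundP e3'0)) _.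
    by rewrite ler_nat; apply: leq_trans h3 _.
  have hK : close1 v e3 (mx (s k).2 *m invmx Y).
    by apply: (close1_quotient Kloc (ltW e30) GY) => i j; exact: le_trans (h1 i j) hm.
  have n1 : near_on_ball v e3 (pnorm v Y y) (pnorm v Y (s k).1.2).
    by apply: (near_pnorm_rc (ltW e30) GY) => i; rewrite distrC ltW.
  have n2 := near_sym (near_pnorm_close1 Kloc n_gt0 (s k).1.2 e31 hK GY).
  rewrite mulmxKV ?GY.1// in n2.
  move=> a' a'1; have := near_trans n1 (near_trans n2 hk) a'1 => /le_trans; apply.
  by rewrite addrCA addrC; move: (k.+1%:R^-1) k3 => q k3; lra.
(* The limit has the norm of (A0, x0), so saturation places it in [O]; openness then places one of
   the counterexamples in [O]. *)
have Oy : O (u, y).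
  apply: Osat O0; apply/(simXE Kloc n_gt0 x0 y A0u (erefl _ : cls A = proj1_sig u) GA0 GY).
  by move=> a; rewrite fE.
have [U [V [[O' [O'o UE]] Vo /UE /= Uu Vy UV]]] := Oo _ Oy.
have [e e0 he] := Abar_open_rc n_gt0 Vo Vy.
have [O'' [O''o O''E]] := O'o.
have [m hm] := O''o _ ((O''E A).1 Uu).
have [k [/= h1 h2]] := filter_ex (filterI (hY `|m|%N) (hy _ e0)).
have [Au GA nO _] := hs k; apply: nO.
rewrite [(s k).1]surjective_pairing; apply: UV; last exact: he.
apply/UE; rewrite -Au; apply/O''E; apply: hm => i j; apply/(closeP v R).
apply: le_trans (h1 i j) _; rewrite ler_expR lerN2 ler_int abszE; exact: ler_norm.
Qed.

End Compactness.

(** * The action of G and its continuity *)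

Section Action.
Variables (K : fieldType) (v : K -> int) (R : realType) (n : nat).
Hypothesis Kloc : nonarch_local_field v.
Hypothesis n_gt0 : (0 < n)%N.
Local Notation abs := (absK v R).
Local Notation mx A := (proj1_sig A).
Local Notation cls A := (qproj (@scal_rel K n) A).
Local Notation snorm := (seminorm v (@weight1 R n)).
Implicit Types (A B M : GLt K n) (x y : Abar R n) (u w : Uhat v R n).
Implicit Types (g : PGL K n) (p q r : PGL K n * Abar R n).

Lemma simG_refl p : simG v p p.
Proof.
case: p => g x; have [A ->] := qproj_surj g; apply/(simGE Kloc n_gt0).
by rewrite mulVmx ?GLt_unit//; apply/preserves_scales/preserves1.
Qed.

Lemma simG_sym p q : simG v p q -> simG v q p.
Proof.
case: p q => g x [h y]; have [A ->] := qproj_surj g; have [B ->] := qproj_surj h.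
have uA := GLt_unit A; have uB := GLt_unit B.
move=> /(simGE Kloc n_gt0) hs; apply/(simGE Kloc n_gt0).
have uM : invmx (mx B) *m mx A \in unitmx by rewrite unitmx_mul unitmx_inv uB.
suff -> : invmx (mx A) *m mx B = invmx (invmx (mx B) *m mx A) by exact: scalesV.
apply: (can_inj (mulmxK uM)); rewrite mulVmx// !mulmxA.
by rewrite -[_ *m mx B *m _]mulmxA mulmxV// mulmx1 mulVmx.
Qed.

Lemma simG_trans p q r : simG v p q -> simG v q r -> simG v p r.
Proof.
case: p q r => g x [h y] [k z]; have [A ->] := qproj_surj g.
have [B ->] := qproj_surj h; have [C ->] := qproj_surj k.
move=> /(simGE Kloc n_gt0) h1 /(simGE Kloc n_gt0) h2; apply/(simGE Kloc n_gt0).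
by have := scalesM h1 h2; rewrite mulmxA mulmxK ?GLt_unit.
Qed.

Lemma eq_qprojG p q : simG v p q -> qproj (@simG K v R n) p = qproj (@simG K v R n) q.
Proof. by apply: eq_qproj; [exact: simG_sym|exact: simG_trans]. Qed.

Lemma qprojX_eq (p q : Uhat v R n * Abar R n) :
  qproj (@simX K v R n) p = qproj (@simX K v R n) q <-> simX p q.
Proof.
split; first by apply: qproj_inj; exact: simG_refl.
by apply: eq_qproj => [a b|a b c]; [exact: simG_sym|exact: simG_trans].
Qed.

(** The decomposition G = U_0 N U_x gives [epsilon] something to select. Whatever it selects,
    possibly with another representative of the class, is tied to the given data by the last
    relation, and this replaces a separate proof that [mu] is well defined. *)
Lemma mu_class g M u A x : cls M = g -> cls A = proj1_sig u -> GLO v R (mx A) ->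
  exists w B y, [/\ cls B = proj1_sig w, GLO v R (mx B),
    mu g (qproj (@simX K v R n) (u, x)) = qproj (@simX K v R n) (w, y) &
    scales v (rc x) (rc y) (invmx (mx B) *m (mx M *m mx A))].
Proof.
move=> Mg Au GA; rewrite /mu; set i := inhabits _; set P := (X in ClassicalEpsilon.epsilon i X).
have uM := GLt_unit M; have uA := GLt_unit A.
have exP : exists z, P z.
  have uMA : mx M *m mx A \in unitmx by rewrite unitmx_mul uM.
  have [X [C [Q [gX NC gQ XE]]]] := bruhat_decomposition Kloc (@weight1_ge0 R n) (rc_ge0 x) uMA.
  have GX : GLO v R X := gen_elementary_preserves Kloc (@weight1_ge0 R n) gX.
  pose V : GLt K n := exist _ X GX.1.
  pose w : Uhat v R n := exist _ (cls V) (@GLO_Uhat K v R n Kloc n_gt0 V GX).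
  have [d [s [d0 CE]]] := NC.
  exists (qproj (@simX K v R n) (w, nuact v d s x)), u, x, M, A, V, w, C, Q, (nuact v d s x).
  split; split => //.
    have [uQ iQ] := gen_elementary_preserves Kloc (rc_ge0 x) gQ.
    by apply/(P_matE Kloc n_gt0); split => //; exact: preserves_scales.
  by exists d, s.
have [u' [x' [M' [A' [V [w [C [Q [y [[eX Mg' Au' Vw] [NC hQ ME hC ->]]]]]]]]]]] :=
  @ClassicalEpsilon.epsilon_spec _ i P exP.
have [B Bw GB] := Uhat_lift Kloc n_gt0 w.
exists w, B, y; split => //.
have uA' := GLt_unit A'; have uB := GLt_unit B.
have h1 : scales v (rc x) (rc x') (invmx (mx A') *m mx A).
  by apply/(simGE Kloc n_gt0); rewrite Au Au'; apply/simG_sym; exact: (qprojX_eq (u', x') (u, x)).1.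
have [b b0 BE] := (cls_eq V B).1 (etrans Vw (esym Bw)).
have [c c0 cE] := (cls_eq M' M).1 (etrans Mg' (esym Mg)).
have [_ hC'] := (nu_relE Kloc C x' y).1 hC.
have [_ hQ'] := (P_matE Kloc n_gt0 x' Q).1 hQ.
have h2 := scalesM h1 (scalesM hQ' hC').
have -> : invmx (mx B) *m (mx M *m mx A) = (b^-1 * c) *: (C *m Q *m (invmx (mx A') *m mx A)).
  rewrite cE BE invmxZ_unit ?GLt_unit// -!scalemxAl -!scalemxAr scalerA; congr (_ *: _).
  have -> : C *m Q = invmx (mx V) *m (mx M' *m mx A').
    by rewrite ME !mulmxA mulVmx ?GLt_unit// mul1mx.
  by rewrite !mulmxA mulmxK.
by apply: scalesZ => //; rewrite mulf_neq0// invr_eq0.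
Qed.

Lemma near_set_sat d f (p q : Uhat v R n * Abar R n) :
  simX p q -> near_set d f p -> near_set d f q.
Proof.
case: p q => u x [w y] h [A [e [/= Au GA ed hA]]].
have [B Bw GB] := Uhat_lift Kloc n_gt0 w.
exists B, e; split => // a a1.
by rewrite -((simXE Kloc n_gt0 x y Au Bw GA GB).1 h a) hA.
Qed.

(* The class of g.s is determined by s up to the factor that makes its maximum on
   O^n equal to 1; this bounds the effect of that renormalization. *)
Lemma near_renormalized (F F0 f f0 : 'cV[K]_n -> R) (c c0 e : R) : 0 < c -> 0 < c0 ->
  (forall a, 0 <= f a) -> (forall a, F a = c * f a) -> (forall a, F0 a = c0 * f0 a) ->
  (forall a, snorm a <= 1 -> F a <= 1) -> (forall a, snorm a <= 1 -> F0 a <= 1) ->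
  (exists2 a, snorm a <= 1 & F a = 1) -> (exists2 a, snorm a <= 1 & F0 a = 1) ->
  near_on_ball v e f f0 -> near_on_ball v (2 * e * c0) F F0.
Proof.
move=> c_gt0 c0_gt0 f_ge0 FE F0E F1 F01 [a1 ha1 Fa1] [a2 ha2 Fa2] h a ha.
have ci : 0 < c^-1 by rewrite invr_gt0.
have c0i : 0 < c0^-1 by rewrite invr_gt0.
have fi b : f b = F b / c by rewrite FE mulrC mulKf// gt_eqF.
have f0i b : f0 b = F0 b / c0 by rewrite F0E mulrC mulKf// gt_eqF.
have le_f b : snorm b <= 1 -> f b <= c^-1.
  by move=> hb; rewrite fi -[leRHS]mul1r ler_pM2r// F1.
have le_f0 b : snorm b <= 1 -> f0 b <= c0^-1.
  by move=> hb; rewrite f0i -[leRHS]mul1r ler_pM2r// F01.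
(* 1 / c and 1 / c0 are the maxima of [f] and [f0] on the unit ball. *)
have cc0 : `|c^-1 - c0^-1| <= e.
  have e1 := h _ ha1; have e2 := h _ ha2.
  have f1 : f a1 = c^-1 by rewrite fi Fa1 mul1r.
  have f2 : f0 a2 = c0^-1 by rewrite f0i Fa2 mul1r.
  have l1 := le_f _ ha2; have l2 := le_f0 _ ha1.
  move: e1 e2; rewrite !ler_norml => /andP[_ e1] /andP[e2 _].
  by apply/andP; split; lra.
have := normalized_dist (f_ge0 a) (le_f _ ha) c0i cc0 (h a ha).
by rewrite !invrK [f a * c]mulrC [f0 a * c0]mulrC -FE -F0E.
Qed.

Lemma mu_continuous : cont (prod_open (@PGL_open K v n) (@Xbar_open K v R n))
  (@Xbar_open K v R n) (fun p : PGL K n * @Xbar K v R n => mu p.1 p.2).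
Proof.
move=> S So [g0 z0] /= S0.
have [[u0 x0] z0E] := qproj_surj z0; have [M0 g0E] := qproj_surj g0.
have [A0 Au0 GA0] := Uhat_lift Kloc n_gt0 u0.
have [w0 [B0 [y0 [Bw0 GB0 mu0 [c0 c0_gt0 hc0]]]]] := mu_class x0 (esym g0E) Au0 GA0.
pose O (p : Uhat v R n * Abar R n) := S (qproj (@simX K v R n) p).
have [||d d0 hd] := @saturated_open_near K v R n Kloc n_gt0 O w0 y0 B0 So _ _ Bw0 GB0.
- by move=> p q /qprojX_eq; rewrite /O => ->.
- by rewrite /O -mu0 -z0E.
have uM0 := GLt_unit M0.
have [b b0 hb] := matrix_bound v R (invmx (mx M0)).
(* M0^-1 may take vectors out of the unit ball; the scalar [t] brings them back, at the price of a
   factor 1 / |t|. *)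
have [t t0 tb] := small_scalar Kloc (ltW b0).
have at0 : 0 < abs t by rewrite absK_gt0.
pose e := Num.min (d / 2) (1 / 2).
have e0 : 0 < e by rewrite lt_min; apply/andP; split; lra.
have e1 : e < 1 by rewrite gt_min; apply/orP; right; lra.
have ed : e <= d / 2 by rewrite ge_min lexx.
(* Chosen so that 2 * (de / |t|) * c0 = d / 2; the other half of [d] is left for the variation of
   the group element. *)
pose de := abs t * (d / (4%:R * c0)).
have de0 : 0 < de by rewrite mulr_gt0// divr_gt0// mulr_gt0// ltr0n.
pose f0 := pnorm v (mx A0) x0.
pose W z := exists2 p : Uhat v R n * Abar R n, z = qproj (@simX K v R n) p & near_set de f0 p.
have WE (p : Uhat v R n * Abar R n) : W (qproj (@simX K v R n) p) <-> near_set de f0 p.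
  by split=> [[q /qprojX_eq/simG_sym]|]; [exact: near_set_sat|exists p].
exists (PGL_ball v e M0), W; split => /=.
- exact: PGL_ball_open.
- move=> p /WE hp; have [U [V [Uo Vo Up Vp UV]]] := near_set_open Kloc n_gt0 hp.
  by exists U, V; split => // a c Ua Vc; apply/WE; exact: UV.
- by rewrite g0E; apply: PGL_ball_center => //; exact: ltW.
- rewrite z0E; apply/WE; exists A0, 0; split => // a _.
  by rewrite subrr normr0.
move=> g z [M [k [s [Mg s0 hk ME]]]] [[u x] -> [A [e' [/= Au GA e'd hA]]]].
have [w [B [y [Bw GB -> h]]]] := mu_class x Mg Au GA.
apply: (hd w y B Bw GB).
have uk := close1_unit Kloc e1 hk; have GkV : GLO v R (invmx k).
  by apply: GLOV; exact: (close1_GLO Kloc e1 hk).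
(* The factor [k] of M = s k M0 stands on the left and lies in GL_n(O), so it can be transferred to
   the result. The norms of [B] and [B'] differ by at most [e], and the fixed matrix [M0]
   remains. *)
have GB' := GLOM GkV GB; set B' := invmx k *m mx B in GB'.
have BB' : mx B = k *m B' by rewrite mulKVmx.
have h' : scales v (rc x) (rc y) (invmx B' *m (mx M0 *m mx A)).
  have -> : invmx B' *m (mx M0 *m mx A) = s^-1 *: (invmx (mx B) *m (mx M *m mx A)).
    apply: (can_inj (mulKmx GB'.1)); rewrite mulKVmx ?GB'.1// -scalemxAr /B' ME.
    rewrite -!mulmxA mulKVmx ?GLt_unit// -!scalemxAl -scalemxAr scalerA mulVf// scale1r.
    by rewrite -mulmxA mulKmx.
  by apply: scalesZ => //; rewrite invr_eq0.
case: h' => c c_gt0 hc.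
have h1 : near_on_ball v e (pnorm v (mx B) y) (pnorm v B' y).
  by rewrite BB'; exact: near_pnorm_close1.
suff h2 : near_on_ball v (d / 2) (pnorm v B' y) (pnorm v (mx B0) y0).
  move=> a a1; apply: le_trans (near_trans h1 h2 a1) _; lra.
have -> : d / 2 = 2 * (de / abs t) * c0.
  by rewrite /de; field; rewrite !gt_eqF.
have pnormE X Y (A' : 'M[K]_n) x' y' (cc : R) : Y \in unitmx -> A' \in unitmx ->
    (forall a, seminorm v (rc y') (invmx X *m (Y *m A') *m a) = cc * seminorm v (rc x') a) ->
    forall a, pnorm v X y' a = cc * pnorm v A' x' (invmx Y *m a).
  move=> uY uA' hX a; rewrite /pnorm -hX; congr (seminorm _ _ _).
  by rewrite -!mulmxA mulKVmx// mulKVmx.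
apply: (near_renormalized c_gt0 c0_gt0 (f := fun a => pnorm v (mx A) x (invmx (mx M0) *m a))
    (f0 := fun a => f0 (invmx (mx M0) *m a))).
- by move=> a; exact: seminorm_ge0.
- by apply: pnormE => //; exact: GLt_unit.
- by apply: pnormE => //; exact: GLt_unit.
- by move=> a; exact: pnorm_le1.
- by move=> a; exact: pnorm_le1.
- exact: pnorm_max.
- exact: pnorm_max.
move=> a a1; rewrite ler_pdivlMr// -[abs t](ger0_norm (ltW at0)) -normrM mulrBl.
rewrite ![_ * abs t]mulrC -!pnormZ//; apply: le_trans (ltW e'd); apply: hA.
rewrite seminormZ//; apply: le_trans tb; rewrite ler_pM2l//.
apply: le_trans (snorm_mulmx Kloc _ (ltW b0) hb) _.
by rewrite ler_piMr ?(ltW b0).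
Qed.

(** Every class in G x Abar meets U_0^ x Abar, and acting on the class of (1, x) finds such a
    representative. *)
Lemma mu_base g x (u1 : Uhat v R n) : proj1_sig u1 = cls (exist _ 1%:M (unitmx1 K n)) ->
  exists p : Uhat v R n * Abar R n, mu g (qproj (@simX K v R n) (u1, x)) = qproj (@simX K v R n) p /\
    simG v (g, x) (proj1_sig p.1, p.2).
Proof.
move=> u1E; have [M gE] := qproj_surj g.
have G1 : GLO v R (1%:M : 'M[K]_n) by split; [exact: unitmx1|exact: preserves1].
have [w [B [y [Bw GB e h]]]] := @mu_class g M u1 _ x (esym gE) (esym u1E) G1.
exists (w, y); split => //=; rewrite gE -Bw; apply/(simGE Kloc n_gt0).
by move: h; rewrite /= mulmx1.
Qed.

End Action.

Theorem theorem4p2 (K : fieldType) (v : K -> int) (R : realType) (n : nat) :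
  nonarch_local_field v -> (0 < n)%N ->
  cont (prod_open (@PGL_open K v n) (@Xbar_open K v R n)) (@Xbar_open K v R n)
       (fun p : PGL K n * @Xbar K v R n => @mu K v R n p.1 p.2) /\
  exists h : @Xbar K v R n -> @Ybar K v R n,
    (forall (u : @Uhat K v R n) (x : Abar R n),
        h (qproj (@simX K v R n) (u, x)) = qproj (@simG K v R n) (proj1_sig u, x)) /\
    homeo (@Xbar_open K v R n) (@Ybar_open K v R n) h.
Proof.
move=> Kloc n_gt0; have mu_cont := @mu_continuous K v R n Kloc n_gt0.
split => //.
pose projX := qproj (@simX K v R n); pose projG := qproj (@simG K v R n).
have eqG p q : simG v p q -> projG p = projG q := @eq_qprojG K v R n Kloc n_gt0 p q.
have eqX p q : projX p = projX q <-> simX p q := @qprojX_eq K v R n Kloc n_gt0 p q.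
have sym := @simG_sym K v R n Kloc n_gt0; have tr := @simG_trans K v R n Kloc n_gt0.
pose I1 : GLt K n := exist _ 1%:M (unitmx1 K n).
have G1 : GLO v R (proj1_sig I1) by split; [exact: unitmx1|exact: preserves1].
pose u1 : Uhat v R n := exist _ (qproj _ I1) (@GLO_Uhat K v R n Kloc n_gt0 I1 G1).
have base g x := @mu_base K v R n Kloc n_gt0 g x u1 erefl.
have [repX hrepX] := choice (@qproj_surj _ (@simX K v R n)).
have [repG hrepG] := choice (@qproj_surj _ (@simG K v R n)).
pose h z := projG (proj1_sig (repX z).1, (repX z).2).
have hE u x : h (projX (u, x)) = projG (proj1_sig u, x).
  by apply: eqG; apply: sym; apply/(eqX (u, x) (repX _)); exact: hrepX.
pose k z := mu (repG z).1 (projX (u1, (repG z).2)).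
(* Although [k] is defined through chosen representatives, its value is the class of any equivalent
   pair in U_0^ x Abar. *)
have kE g x (p : Uhat v R n * Abar R n) : simG v (g, x) (proj1_sig p.1, p.2) ->
    k (projG (g, x)) = projX p.
  move=> gp; have [q [kq hq]] := base (repG (projG (g, x))).1 (repG (projG (g, x))).2.
  have rel := sym _ _ (qproj_inj (simG_refl Kloc n_gt0 _) (hrepG (projG (g, x)))).
  rewrite -surjective_pairing in hq.
  by rewrite /k -/projX kq; apply/eqX; exact: tr (tr _ _ _ (sym _ _ hq) rel) gp.
have kmu g x : k (projG (g, x)) = mu g (projX (u1, x)).
  by have [p [-> hp]] := base g x; exact: kE.
exists h; split => //; exists k; split.
- move=> z; have [[u x] ->] := qproj_surj z.
  by rewrite -/projX hE; apply: kE; exact: simG_refl.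
- move=> z; have [[g x] ->] := qproj_surj z.
  have [[w y] [e hp]] := base g x.
  by rewrite -/projG kmu e hE; apply: eqG; exact: sym.
- move=> S So [u x] Sux; rewrite -/projX hE in Sux.
  have [U [V [Uo Vo Uu Vx UV]]] := So (proj1_sig u, x) Sux.
  exists (fun w => U (proj1_sig w)), V; split => //; first by exists U.
  by move=> w y Uw Vy; rewrite -/projX hE; exact: UV.
- move=> S So [g x] Sgx; rewrite -/projG kmu in Sgx.
  have [U [W [Uo Wo Ug Wx UW]]] := mu_cont S So (g, projX (u1, x)) Sgx.
  exists U, (fun y => W (projX (u1, y))); split => //.
    (* With [u1] fixed, only the second factor V' of the rectangle is needed: this is continuity of
       x |-> [1, x]. *)
    move=> y Wy; have [U' [V' [_ V'o U'1 V'y UV']]] := Wo (u1, y) Wy.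
    have [B [Bb By BV]] := V'o y V'y; exists B; split => // q /BV V'q.
    exact: (UV' u1 q).
  by move=> g' x' Ug' Wx'; rewrite -/projG kmu; exact: UW Ug' Wx'.
Qed.
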